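(* Let $E_\bullet$ be an Arnold space, $M_\bullet$ a closed subspace of $E_\bullet^{(\mu)}$ for some $\mu\ge 0$, and $F_\bullet,G_\bullet$ an $m$-bounded splitting of $M_\bullet$ for some $m\ge 0$. Consider a vector subspace $\mathfrak{g}_\bullet\subset \mathcal{M}^1(E_\bullet)^{(2)}$ which leaves $G_\bullet$ invariant, and let $a\in E_0$ be such that $\mathfrak{g}_\bullet$ maps $a$ into $G_\bullet$. Consider the linear maps $$\rho(\alpha):\mathfrak{g}_\bullet\to G_\bullet,\qquad u\mapsto u(a+\alpha).$$ Assume that for some $k,l\ge 0$ and some sequence $r=(r_n)$: A) for each $\alpha\in F_\bullet$, there is a $k$-tamed right quasi-inverse $j(\alpha)\in\mathcal{M}^k(G_\bullet,\mathfrak{g}_\bullet)$ of $\rho(\alpha)$; B) the map $j:F_\bullet\supset B(r,l)\to\mathcal{M}^k(G_\bullet,\mathfrak{g}_\bullet)$, $\alpha\mapsto j(\alpha)$, is $l$-tamed; C) $\mu>2k+l+m+2$. Then for any $b\in M_0$ and any $A\in\,]1,2[$ there exists a $1$-tamed morphism $u_\bullet=(u_n)$ of $E_\bullet$ such that i) $u_i\in\mathfrak{g}_i$ for every $i$; ii) $N^1_s(u_n)<s^{k+l+m+2}e^{-A^n}$ for any $s$ sufficiently small and any $n\ge 0$; iii) $g(a+b)=r(a)\ (\mathrm{mod}\ F_\infty)$, where $g$ is the limit of the sequence $(e^{u_n}e^{u_{n-1}}\cdots e^{u_1}e^{u_0})_{n\in\mathbb{N}}$, taken in $\mathcal{L}(E_0,E_\infty)$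 after restriction to $E_\infty$, and $r:E_0\to E_\infty$ is the restriction map.
   Context: **Scaled vector spaces.** Let $S>0$. An $S$-scaled vector space is a directed system of Banach spaces $E=(E_s)_{s\in]0,S[}$ with injective continuous linear maps $f_{ts}:E_t\to E_s$ for $t>s$, of operator norm at most one. For $x\in E_t$ and $s\le t$, $|x|_s$ denotes the norm of the image of $x$ in $E_s$; put $|x|_s=+\infty$ if $s>t$. A morphism $E\to F$ of $S$-scaled vector spaces is given by a function $\phi:]0,S[\to]0,S[$ and continuous linear maps $E_t\to F_{\phi(t)}$ commuting with the maps of the directed systems. $\mathcal{L}(E,F)$ is the space of morphisms, with the strong topology, and $\mathcal{L}(E)=\mathcal{L}(E,E)$. The canonical filtration of $E$ is $E^{(k)}=\{x\in E:\exists C,\tau,\ |x|_s\le Cs^k\ \forall s\le\tau\}$. A $\tau$-morphism $u:E\to F$ ($\tau<S$) is a collection of morphisms $u_\sigma$, $\sigma\in]0,\tau]$, where $u_\sigma$ maps $E_t$ to $F_{t-\sigma}$, compatible with the maps of the directed systems. Thus $u(x)\in F_s$ is defined for $x\in E_t$, $s<t\le\tau$. It is $k$-bounded if there is $C>0$ with $|u(x)|_s\le \frac{C}{(t-s)^k}|x|_t$ for all $s<t\le\tau$, $x\in E_t$ (for $k=0$ also for $s=t$). A morphism is $k$-bounded if it is a $k$-bounded $\tau$-morphism for some $\tau$. For a $k$-bounded $\tau$-morphism let $C^k_\tau(u)$ be the smallest such $C$ and set $N^k_\tau(u)=e\,C^k_\tau(u)$, $e=2.71\dots$. The spaces $\mathcal{B}^k_\tau(E,F)$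 of $k$-bounded $\tau$-morphisms with norms $N^k_\tau$ form an $S$-scaling of the space $\mathcal{B}^k(E,F)$ of $k$-bounded morphisms. A restriction or projection map which is $k$-bounded is said to have ''norm at most one'' if the defining estimate holds with $C=1$. The exponential of a $1$-bounded morphism is $e^u=\sum_{j\ge0}u^j/j!$. **Arnold spaces.** Put $\overline{\mathbb{N}}=\mathbb{N}\cup\{+\infty\}$. An $S$ pre-Arnold space is a product $E_\bullet=\prod_{n\in\overline{\mathbb{N}}}E_n$ of $S$-scaled vector spaces, with the product topology. Morphisms $u_\bullet=(u_n)$ are families of morphisms of scaled vector spaces $u_n:E_n\to F_n$; $\tau$-morphisms, $k$-bounded morphisms and the filtrations $E_\bullet^{(k)}$ are defined componentwise, and $N^k_\tau(u_\bullet)=(N^k_\tau(u_n))$ is a sequence. An Arnold space is a directed system of $S$-scaled vector spaces $E_n$, $n\in\overline{\mathbb{N}}$, with restriction morphisms $r_{ij}:E_i\to E_j$ ($i<j$) that are $0$-bounded with norm at most one; morphisms of Arnold spaces are morphisms of the underlying pre-Arnold spaces (they need not commute with restrictions). One writes $r_m:E_n\to E_m$ and $r:E_n\to E_\infty$ for restrictions, $|x|_{n,s}$ for the norm of (the projection of $x$ to) $(E_n)_s=E_{n,s}$, and for $u:E_n\to E_n$, $v:E_{n+k}\to E_{n+k}$, $vu$ means $v\,r_{n+k}\,u$. Similarly $u_n(a)$ for $a\in E_0$ means $u_n(r_na)$. **Tameness.** An increasing positive real sequence $(p_n)$ is tamed if $\sum_{n\ge0}\frac{\log\max(1,p_n)}{2^n}<+\infty$.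 A $k$-bounded $\tau$-morphism $u_\bullet$ between pre-Arnold spaces is $k$-tamed if the sequence $(N^k_\tau(u_n))$ is tamed. $\mathcal{M}^k(E_\bullet,F_\bullet)$ is the vector space of $k$-tamed morphisms, $\mathcal{M}^k(E_\bullet)=\mathcal{M}^k(E_\bullet,E_\bullet)$; being a subspace of the $k$-bounded morphisms (whose components are normed by $N^k_s$) it inherits the canonical filtration $\mathcal{M}^k(\cdot,\cdot)^{(i)}$. In particular elements of $\mathfrak{g}_\bullet$ are measured with the norms $N^1_s$, and $j(\alpha)_n$ with $N^k_s$. For a sequence $r=(r_n)$, $B(r,k)\subset E_\bullet$ is the union of the sets $B(r,k)_{n,t}=\{x\in E_{n,t}:|x|_{n,t}<r_nt^k\}$. A map of Arnold spaces $f:E_\bullet\supset B(r,k)\to F_\bullet$ is tamed by a sequence $(p_n)$ with $p_n^{-1}<r_n$ if $(p_n)$ is tamed and there is $C>0$ such that $|x|_{n,t}\le\frac{(t-s)^k}{p_n}$ implies $|f(x)|_{n,s}\le C$. It is called $k$-tamed (for a map defined on $B(r,k)$) if it is tamed by some such sequence. **Quasi-inverses.** For $d\ge0$ and a scaled vector space $E$, let $\mathcal{H}^k_d(E_t)=\{x\in E_t:|x|_s\le\frac{1}{(t-s)^d}\left(\frac st\right)^{2^k}|x|_t\ \forall s<t\}$ (harmonic filtration; $\mathcal{H}^k_d(E)$ consists of the elements of these sets). A right $d$-quasi-inverse of a morphism $u:E_\bullet\to F_\bullet$ is a morphism $v:F_\bullet\to E_\bullet$ with $y-uv(y)\in\mathcal{H}^n_d(F_n)$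 for all $n\in\mathbb{N}$, $y\in F_n$. In the theorem, ''right quasi-inverse'' means right $d$-quasi-inverse for some fixed $d\ge0$. **Splittings.** $F_\bullet,G_\bullet$ define a $k$-bounded splitting of $M_\bullet$ if $M_\bullet$ is the direct sum of $F_\bullet$ and $G_\bullet$, both are closed, and the projection on each factor is $k$-bounded with norm at most one.
   Formalization: Formal version assumes: restrictions have norm at most one up to a common level; M, F, G are stable under restrictions; the quasi-inverse defect is harmonic at every level below one common to all n and y. Tamed morphisms need not have increasing norms. Without these the claim fails. *)

(* Defs.v *)
From HB Require Import structures.
From mathcomp Require Import all_boot all_order all_algebra generic_quotient.
From mathcomp Require Import all_classical all_reals all_analysis.

Set Implicit Arguments.
Unset Strict Implicit.
Unset Printing Implicit Defensive.

Import Order.TTheory GRing.Theory Num.Theory.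
Import numFieldNormedType.Exports.

Local Open Scope classical_set_scope.
Local Open Scope ring_scope.

(** Banach spaces are taken over the reals; complex ones, complex linear maps
    and complex subspaces are covered by restriction of scalars.
    The families [lv] and [lvmap] are total in their real indices, but only the
    indices in ]0, S[ are meaningful.  Continuity of [lvmap t s] is a
    consequence of [lvmap_norm]. *)
Record scaled (R : realType) (S : R) := Scaled {
  lv : R -> completeNormedModType R;
  lvmap : forall t s : R, {linear lv t -> lv s};
  scale_gt0 : 0 < S;
  lvmap_norm : forall (t s : R) (x : lv t),
    0 < s -> s <= t -> t < S -> `|lvmap t s x| <= `|x|;
  lvmap_inj : forall t s : R,
    0 < s -> s <= t -> t < S -> injective (lvmap t s);
  lvmap_id : forall (t : R) (x : lv t), 0 < t < S -> lvmap t t x = x;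
  lvmap_comp : forall (t s q : R) (x : lv t),
    0 < q -> q <= s -> s <= t -> t < S ->
    lvmap s q (lvmap t s x) = lvmap t q x }.

(** "x in E" means that x belongs to some E_t, and x is identified with its
    images in the E_s, s < t: the elements of E are those of the direct limit
    [germ E] of the system. *)
Section DirectLimit.
Variables (R : realType) (S : R) (E : scaled S).

Record rep := Rep { rlev : R; rlevP : 0 < rlev < S; rval : lv E rlev }.

HB.instance Definition _ := gen_eqMixin rep.
HB.instance Definition _ := gen_choiceMixin rep.

Definition at_level (p : rep) (s : R) : lv E s := lvmap E (rlev p) s (rval p).

Definition rep_eq (p q : rep) : bool :=
  let s := Num.min (rlev p) (rlev q) in at_level p s == at_level q s.

Lemma at_level_comp (p : rep) (s q : R) :
  0 < q -> q <= s -> s <= rlev p -> lvmap E s q (at_level p s) = at_level p q.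
Proof.
by move=> q0 qs sp; apply: lvmap_comp => //; case/andP: (rlevP p).
Qed.

Lemma rep_eqP (p q : rep) (s : R) :
  0 < s -> s <= rlev p -> s <= rlev q ->
  rep_eq p q = (at_level p s == at_level q s).
Proof.
move=> s0 sp sq; rewrite /rep_eq.
set m := Num.min _ _.
have sm : s <= m by rewrite le_min sp.
have mp : m <= rlev p by rewrite ge_min lexx.
have mq : m <= rlev q by rewrite ge_min lexx orbT.
have mS : m < S by apply: le_lt_trans mp _; case/andP: (rlevP p).
rewrite -(at_level_comp s0 sm mp) -(at_level_comp s0 sm mq).
by rewrite (inj_eq (lvmap_inj s0 sm mS)).
Qed.

Lemma rep_eq_refl : reflexive rep_eq.
Proof. by move=> p; rewrite /rep_eq eqxx. Qed.

Lemma rep_eq_sym : symmetric rep_eq.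
Proof. by move=> p q; rewrite /rep_eq minC eq_sym. Qed.

Lemma rep_eq_trans : transitive rep_eq.
Proof.
move=> q p r; pose s := Num.min (rlev p) (Num.min (rlev q) (rlev r)).
have s0 : 0 < s.
  by rewrite !lt_min; case/andP: (rlevP p) => -> _; case/andP: (rlevP q) => -> _;
     case/andP: (rlevP r) => -> _.
have sp : s <= rlev p by rewrite ge_min lexx.
have sq : s <= rlev q by rewrite !ge_min lexx !orbT.
have sr : s <= rlev r by rewrite !ge_min lexx !orbT.
by rewrite !(@rep_eqP _ _ s)// => /eqP -> /eqP ->.
Qed.

Canonical rep_equiv := EquivRel rep_eq rep_eq_refl rep_eq_sym rep_eq_trans.

Definition germ := {eq_quot rep_equiv}%qT.

HB.instance Definition _ := Choice.on germ.

Definition germ_of (t : R) (ht : 0 < t < S) (x : lv E t) : germ :=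
  (\pi_({eq_quot rep_equiv}) (Rep ht x))%qT.

Lemma half_scale : 0 < S / 2 < S.
Proof.
have S0 := scale_gt0 E.
by rewrite divr_gt0//= ltr_pdivrMr// ltr_pMr// ltr1n.
Qed.

Lemma min_scale (s t : R) : 0 < s < S -> 0 < t < S -> 0 < Num.min s t < S.
Proof.
by case/andP=> s0 sS /andP[t0 tS]; rewrite lt_min s0 t0 /= gt_min sS.
Qed.

Lemma germ_ofP (t : R) (ht : 0 < t < S) : injective (germ_of ht).
Proof.
move=> x y /eqmodP; rewrite /= (@rep_eqP _ _ t)//=; last by case/andP: ht.
by rewrite /at_level /= !lvmap_id// => /eqP.
Qed.

Lemma germ_of_lvmap (t s : R) (ht : 0 < t < S) (hs : 0 < s < S) (x : lv E t) :
  s <= t -> germ_of hs (lvmap E t s x) = germ_of ht x.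
Proof.
move=> st; apply/eqmodP => /=; case/andP: (hs) => s0 sS; case/andP: (ht) => t0 tS.
by rewrite (@rep_eqP _ _ s)//= /at_level /= lvmap_id.
Qed.

Lemma germ_of_surj (x : germ) : exists (t : R) (ht : 0 < t < S) (y : lv E t), x = germ_of ht y.
Proof.
elim/quotW: x => -[t ht y].
by exists t, ht, y.
Qed.

Lemma germ_of_le (x : germ) (t : R) (ht : 0 < t < S) (y : lv E t) (s : R) :
  x = germ_of ht y -> 0 < s -> s <= t ->
  exists (hs : 0 < s < S) (z : lv E s), x = germ_of hs z.
Proof.
move=> -> s0 st.
have hs : 0 < s < S by rewrite s0 (le_lt_trans st)//; case/andP: ht.
by exists hs, (lvmap E t s y); rewrite (germ_of_lvmap ht).
Qed.

Lemma germ_of_surj2 (x y : germ) : exists (t : R) (ht : 0 < t < S) (x' y' : lv E t),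
  x = germ_of ht x' /\ y = germ_of ht y'.
Proof.
have [s [hs [x' ->]]] := germ_of_surj x; have [t [ht [y' ->]]] := germ_of_surj y.
have hm := min_scale hs ht.
exists (Num.min s t), hm, (lvmap E s _ x'), (lvmap E t _ y').
by rewrite (germ_of_lvmap hs) ?ge_min ?lexx// (germ_of_lvmap ht) ?ge_min ?lexx ?orbT.
Qed.

Lemma germ_of_surj3 (x y z : germ) :
  exists (t : R) (ht : 0 < t < S) (x' y' z' : lv E t),
  [/\ x = germ_of ht x', y = germ_of ht y' & z = germ_of ht z'].
Proof.
have [s [hs [x' [y' [-> ->]]]]] := germ_of_surj2 x y.
have [t [ht [z' ->]]] := germ_of_surj z.
have hm := min_scale hs ht.
exists (Num.min s t), hm, (lvmap E s _ x'), (lvmap E s _ y'), (lvmap E t _ z').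
by rewrite !(germ_of_lvmap hs) ?ge_min ?lexx// (germ_of_lvmap ht) ?ge_min ?lexx ?orbT.
Qed.

Definition germ0 : germ := germ_of half_scale 0.

Definition germD (x y : germ) : germ :=
  let p := repr x in let q := repr y in
  let s := Num.min (rlev p) (rlev q) in
  germ_of (min_scale (rlevP p) (rlevP q)) (at_level p s + at_level q s).

Definition germN (x : germ) : germ :=
  germ_of (rlevP (repr x)) (- rval (repr x)).

Definition germZ (c : R) (x : germ) : germ :=
  germ_of (rlevP (repr x)) (c *: rval (repr x)).

Lemma germ_of_repr (x : germ) : germ_of (rlevP (repr x)) (rval (repr x)) = x.
Proof.
rewrite -[RHS]reprK /germ_of; congr (\pi _)%qT.
by case: (repr x).
Qed.

Lemma repr_germ_of (t : R) (ht : 0 < t < S) (x : lv E t) (s : R) :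
  0 < s -> s <= t -> s <= rlev (repr (germ_of ht x)) ->
  at_level (repr (germ_of ht x)) s = lvmap E t s x.
Proof.
move=> s0 st sr; apply/eqP.
have : germ_of (rlevP (repr (germ_of ht x))) (rval (repr (germ_of ht x))) = germ_of ht x.
  exact: germ_of_repr.
move=> /eqmodP /=; rewrite (@rep_eqP _ _ s)//=.
Qed.

Lemma germ_of0 (t : R) (ht : 0 < t < S) : germ_of ht 0 = germ0.
Proof.
have hm := min_scale ht half_scale.
rewrite -(@germ_of_lvmap _ _ ht hm) ?ge_min ?lexx// linear0 /germ0.
by rewrite -(@germ_of_lvmap _ _ half_scale hm) ?ge_min ?lexx ?orbT// linear0.
Qed.

Lemma germ_ofD (t : R) (ht : 0 < t < S) (x y : lv E t) :
  germ_of ht (x + y) = germD (germ_of ht x) (germ_of ht y).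
Proof.
rewrite /germD; set p := repr (germ_of ht x); set q := repr (germ_of ht y).
set hm := min_scale _ _; set m := Num.min _ _ in hm *.
have hn := min_scale ht hm.
have nt : Num.min t m <= t by rewrite ge_min lexx.
have nm : Num.min t m <= m by rewrite ge_min lexx orbT.
have mp : m <= rlev p by rewrite ge_min lexx.
have mq : m <= rlev q by rewrite ge_min lexx orbT.
have n0 : 0 < Num.min t m by case/andP: hn.
rewrite -(germ_of_lvmap ht hn)// -(germ_of_lvmap hm hn)//; congr germ_of.
rewrite !linearD /= !at_level_comp// !repr_germ_of//.
- exact: le_trans nm mq.
- exact: le_trans nm mp.
Qed.

Lemma germ_ofN (t : R) (ht : 0 < t < S) (x : lv E t) :
  germ_of ht (- x) = germN (germ_of ht x).
Proof.
rewrite /germN; set p := repr (germ_of ht x).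
have hm := min_scale ht (rlevP p); set m := Num.min _ _ in hm.
have mt : m <= t by rewrite ge_min lexx.
have mp : m <= rlev p by rewrite ge_min lexx orbT.
rewrite -(germ_of_lvmap ht hm)// -(germ_of_lvmap (rlevP p) hm)//; congr germ_of.
by rewrite !linearN /= -repr_germ_of//; case/andP: hm.
Qed.

Lemma germ_ofZ (t : R) (ht : 0 < t < S) (c : R) (x : lv E t) :
  germ_of ht (c *: x) = germZ c (germ_of ht x).
Proof.
rewrite /germZ; set p := repr (germ_of ht x).
have hm := min_scale ht (rlevP p); set m := Num.min _ _ in hm.
have mt : m <= t by rewrite ge_min lexx.
have mp : m <= rlev p by rewrite ge_min lexx orbT.
rewrite -(germ_of_lvmap ht hm)// -(germ_of_lvmap (rlevP p) hm)//; congr germ_of.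
by rewrite !linearZ /= -repr_germ_of//; case/andP: hm.
Qed.

Lemma germDA : associative germD.
Proof.
move=> x y z; have [t [ht [x' [y' [z' [-> -> ->]]]]]] := germ_of_surj3 x y z.
by rewrite -!germ_ofD addrA.
Qed.

Lemma germDC : commutative germD.
Proof.
move=> x y; have [t [ht [x' [y' [-> ->]]]]] := germ_of_surj2 x y.
by rewrite -!germ_ofD addrC.
Qed.

Lemma germ0D : left_id germ0 germD.
Proof.
by move=> x; have [t [ht [y ->]]] := germ_of_surj x; rewrite -(germ_of0 ht) -germ_ofD add0r.
Qed.

Lemma germND : left_inverse germ0 germN germD.
Proof.
move=> x; have [t [ht [y ->]]] := germ_of_surj x.
by rewrite -germ_ofN -germ_ofD addNr germ_of0.
Qed.

HB.instance Definition _ :=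
  GRing.isZmodule.Build germ germDA germDC germ0D germND.

Lemma germZA (a b : R) (x : germ) : germZ a (germZ b x) = germZ (a * b) x.
Proof.
by have [t [ht [y ->]]] := germ_of_surj x; rewrite -!germ_ofZ scalerA.
Qed.

Lemma germ1Z : left_id 1 germZ.
Proof.
by move=> x; have [t [ht [y ->]]] := germ_of_surj x; rewrite -!germ_ofZ scale1r.
Qed.

Lemma germZDr : right_distributive germZ +%R.
Proof.
move=> a x y; have [t [ht [x' [y' [-> ->]]]]] := germ_of_surj2 x y.
rewrite -[LHS]/(germZ a (germD _ _)) -[RHS]/(germD _ _).
by rewrite -germ_ofD -germ_ofZ scalerDr germ_ofD !germ_ofZ.
Qed.

Lemma germZDl (x : germ) : {morph germZ^~ x : a b / a + b}.
Proof.
move=> a b /=; have [t [ht [y ->]]] := germ_of_surj x.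
by rewrite -[RHS]/(germD _ _) -!germ_ofZ -germ_ofD scalerDl.
Qed.

HB.instance Definition _ :=
  GRing.Zmodule_isLmodule.Build R germ germZA germ1Z germZDr germZDl.

Lemma germ_of_linear (t : R) (ht : 0 < t < S) : linear (@germ_of t ht).
Proof.
by move=> c x y; rewrite germ_ofD germ_ofZ.
Qed.

HB.instance Definition _ (t : R) (ht : 0 < t < S) :=
  GRing.isLinear.Build R (lv E t) germ *:%R (@germ_of t ht) (germ_of_linear ht).

(** |x|_t, with value +oo when x does not belong to E_t *)
Definition germ_norm (t : R) (x : germ) : \bar R :=
  ereal_inf [set `|y|%:E | y in
    [set y : lv E t | exists ht : 0 < t < S, germ_of ht y = x]].

Lemma germ_norm_germ_of (t : R) (ht : 0 < t < S) (y : lv E t) :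
  germ_norm t (germ_of ht y) = `|y|%:E.
Proof.
rewrite /germ_norm (_ : [set z | _] = [set y]) ?image_set1 ?ereal_inf1//.
apply/seteqP; split=> z /=; last by move=> ->; exists ht.
by case=> ht'; rewrite (Prop_irrelevance ht' ht) => /germ_ofP.
Qed.

(** B is closed relatively to A, closedness being tested in each E_t. *)
Definition closed_in (A B : set germ) : Prop :=
  B `<=` A /\
  forall (t : R) (ht : 0 < t < S) (y : lv E t),
    A (germ_of ht y) -> closure (germ_of ht @^-1` B) y -> B (germ_of ht y).

End DirectLimit.

(** Common framework for a scaled vector space, for its subspaces and for
    spaces of morphisms: the elements at level t are the x in [ns_dom] whose
    t-norm is finite. *)
Record nscale (R : realType) := NScale {
  ns_car :> lmodType R;
  ns_dom : set ns_car;
  ns_nrm : R -> ns_car -> \bar R }.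

Definition sub_scale (R : realType) (S : R) (E : scaled S)
  (M : set (germ E)) : nscale R := NScale M (@germ_norm R S E).

Definition full_scale (R : realType) (S : R) (E : scaled S) : nscale R :=
  sub_scale (E := E) setT.

(** The canonical filtration X^(k) *)
Definition filtration (R : realType) (X : nscale R) (k : R) : set X :=
  [set x | ns_dom x /\ exists C tau : R, 0 < tau /\
     forall s : R, 0 < s <= tau -> (ns_nrm s x <= (C * s `^ k)%:E)%E].

Definition subspace (R : realType) (V : lmodType R) (M : set V) : Prop :=
  M 0 /\ forall (c : R) (x y : V), M x -> M y -> M (c *: x + y).

(** The compatible maps E_t -> F_s, s < t <= tau, of a tau-morphism are the
    same thing as one linear map between the spaces of elements; the estimate
    with finite constant forces it to map E_t to F_s continuously.  For k = 0
    and s = t the factor is 0 `^ 0 = 1. *)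
Section Bounded.
Variables (R : realType) (X Y : nscale R).

Definition bounded_by (k tau C : R) (u : X -> Y) : Prop :=
  forall s t : R, 0 < s -> s <= t -> t <= tau -> s < t \/ k = 0 ->
  forall x : X, ns_dom x ->
    (ns_nrm s (u x) <= (C / (t - s) `^ k)%:E * ns_nrm t x)%E.

(** C^k_tau (u) and N^k_tau (u), equal to +oo when u is not k-bounded up to
    tau *)
Definition Ck (k tau : R) (u : X -> Y) : \bar R :=
  ereal_inf [set C%:E | C in [set C : R | 0 < C /\ bounded_by k tau C u]].

Definition Nk (k tau : R) (u : X -> Y) : \bar R :=
  ((expR 1)%:E * Ck k tau u)%E.

Definition linear_on (u : X -> Y) : Prop :=
  (forall x : X, ns_dom x -> ns_dom (u x)) /\
  forall (c : R) (x y : X), ns_dom x -> ns_dom y ->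
    u (c *: x + y) = c *: u x + u y.

Definition bounded_mor (k tau : R) (u : X -> Y) : Prop :=
  linear_on u /\ (Nk k tau u < +oo)%E.

End Bounded.

Arguments bounded_by {R} X Y k tau C u.
Arguments Nk {R} X Y k tau u.

(** A space of 1-bounded morphisms E -> F, measured by the norms N^1_s *)
Definition mor_scale (R : realType) (S : R) (E F : scaled S)
  (D : set (germ E -> germ F)) : nscale R :=
  @NScale R (germ E -> germ F) D
    (fun s u => Nk (full_scale E) (full_scale F) 1 s u).

Section Morphisms.
Variables (R : realType) (S : R).

(** The choice of s for each t is the function phi. *)
Definition is_morphism (E F : scaled S) (u : germ E -> germ F) : Prop :=
  linear u /\
  forall t : R, 0 < t < S -> exists s C : R, [/\ 0 < s < S, 0 < C &
    forall x : germ E, (germ_norm s (u x) <= C%:E * germ_norm t x)%E].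

(** Strong topology: convergence in operator norm from each E_t to some F_s,
    that is, uniformly on the unit balls of the E_t. *)
Definition cvg_mor (E F : scaled S) (u : nat -> germ E -> germ F)
  (v : germ E -> germ F) : Prop :=
  forall t : R, 0 < t < S -> exists2 s : R, 0 < s < S &
    forall eps : R, 0 < eps -> \forall N \near \oo,
      forall x : germ E, (germ_norm s (u N x - v x)%R <= eps%:E * germ_norm t x)%E.

Definition is_exp (E : scaled S) (u w : germ E -> germ E) : Prop :=
  is_morphism w /\
  cvg_mor (fun N x => \sum_(j < N) (j`!%:R : R)^-1 *: iter j u x) w.

End Morphisms.

(** [None] is the index +oo. *)
Definition natbar := option nat.

Definition lenb (i j : natbar) : bool :=
  match i, j with
  | _, None => true
  | Some m, Some n => (m <= n)%N
  | None, Some _ => false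
  end.

(** The level tau up to which the restrictions are norm-decreasing is the same
    for all pairs of indices, as for any tau-morphism of product spaces. *)
Record arnold (R : realType) (S : R) := Arnold {
  ar :> natbar -> scaled S;
  res : forall i j : natbar, {linear germ (ar i) -> germ (ar j)};
  res_id : forall (i : natbar) (x : germ (ar i)), res i i x = x;
  res_comp : forall (i j l : natbar) (x : germ (ar i)),
    lenb i j -> lenb j l -> res j l (res i j x) = res i l x;
  res_bounded : exists2 tau : R, 0 < tau < S & forall i j : natbar, lenb i j ->
    bounded_by (full_scale (ar i)) (full_scale (ar j)) 0 tau 1 (res i j) }.

Definition log_summable (R : realType) (p : nat -> R) : Prop :=
  cvgn (series (fun n => ln (Num.max 1 (p n)) / 2 ^+ n)).

Definition tamed_seq (R : realType) (p : nat -> R) : Prop :=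
  [/\ forall n, 0 < p n, nondecreasing_seq p & log_summable p].

(** The sequence N^k_tau (u_n) is not required to be monotone: otherwise the
    k-tamed morphisms would not form a vector space. *)
Definition tamed_mor (R : realType) (S k : R) (X Y : natbar -> nscale R)
  (u : forall n, X n -> Y n) : Prop :=
  exists tau : R, [/\ 0 < tau < S,
    forall n, bounded_mor k tau (u n) &
    log_summable (fun n => fine (Nk (X (Some n)) (Y (Some n)) k tau (u (Some n))))].

Arguments tamed_mor {R} S k X Y u.

(** B(r, k), as a part of the product *)
Definition tame_ball (R : realType) (S : R) (X : natbar -> nscale R)
  (r : nat -> R) (k : R) : set (forall n, X n) :=
  [set x | forall n : nat, exists2 t : R, 0 < t < S &
     (ns_nrm t (x (Some n)) < (r n * t `^ k)%:E)%E].

Definition tamed_map (R : realType) (S k : R) (X Y : natbar -> nscale R)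
  (r : nat -> R) (f : (forall n, X n) -> forall n, Y n) : Prop :=
  exists p : nat -> R, [/\ tamed_seq p, forall n, (p n)^-1 < r n &
    exists2 C : R, 0 < C &
      forall x : forall n, X n,
        (forall n, ns_dom (x n)) -> tame_ball S r k x ->
      forall (n : nat) (s t : R), 0 < s -> s < t -> t < S ->
        (ns_nrm t (x (Some n)) <= ((t - s) `^ k / p n)%:E)%E ->
        (ns_nrm s (f x (Some n)) <= C%:E)%E].

Arguments tamed_map {R} S k X Y r f.

(** Component of the space of k-tamed morphisms, measured by the norms N^k_s *)
Definition bmor_scale (R : realType) (k : R) (X Y : nscale R) : nscale R :=
  @NScale R (X -> Y) (@linear_on R X Y) (fun s v => Nk X Y k s v).

Definition harm_filt (R : realType) (d : R) (k : nat) (X : nscale R) (t : R) :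
  set X :=
  [set x | ns_dom x /\ (ns_nrm t x < +oo)%E /\
     forall s : R, 0 < s -> s < t ->
       (ns_nrm s x <=
        ((t - s) `^ (- d) * (s / t) ^+ (2 ^ k))%:E * ns_nrm t x)%E].

(** Membership of y - u v (y) in the harmonic space is understood at each level
    t <= tau where the element is defined, for a common tau. *)
Definition right_quasi_inverse (R : realType) (S d : R)
  (X Y : natbar -> nscale R) (u : forall n, X n -> Y n)
  (v : forall n, Y n -> X n) : Prop :=
  exists2 tau : R, 0 < tau < S &
    forall (n : nat) (y : Y (Some n)), ns_dom y ->
      let z := y - u (Some n) (v (Some n) y) in
      ns_dom z /\
      forall t : R, 0 < t <= tau -> (ns_nrm t z < +oo)%E -> harm_filt d n t z.

Arguments right_quasi_inverse {R} S d X Y u v.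

Section Subspaces.
Variables (R : realType) (S : R) (A : arnold S).

Definition subfamily := forall n : natbar, set (germ (A n)).

Definition arnold_subspace (M : subfamily) : Prop :=
  (forall n, subspace (M n)) /\
  forall (i j : natbar) (x : germ (A i)), lenb i j -> M i x -> M j (res A i j x).

Definition closed_family (B M : subfamily) : Prop :=
  forall n, closed_in (B n) (M n).

(** E^(k) *)
Definition filtration_family (k : R) : subfamily :=
  fun n => filtration (X := full_scale (A n)) k.

Definition splitting (m : R) (M F G : subfamily) : Prop :=
  [/\ arnold_subspace F /\ arnold_subspace G,
      closed_family M F /\ closed_family M G,
      forall n x, F n x -> G n x -> x = 0 &
      exists pF pG : forall n, germ (A n) -> germ (A n),
        forall n,
        [/\ forall x, M n x -> [/\ F n (pF n x), G n (pG n x) & x = pF n x + pG n x],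
            exists2 tau : R, 0 < tau < S &
              bounded_by (sub_scale (M n)) (sub_scale (F n)) m tau 1 (pF n) &
            exists2 tau : R, 0 < tau < S &
              bounded_by (sub_scale (M n)) (sub_scale (G n)) m tau 1 (pG n)]].

(** Sequences (u_n) of endomorphisms of the spaces E_n, which need not commute
    with the restrictions *)
Definition endo := forall n : natbar, germ (A n) -> germ (A n).

Definition is_tamed1 (u : endo) : Prop :=
  tamed_mor S 1 (fun n => full_scale (A n)) (fun n => full_scale (A n)) u.

(** M^1(E)^(i) *)
Definition tamed1_filtration (i : R) : set endo :=
  [set u | is_tamed1 u /\
     forall n, filtration (X := @mor_scale R S (A n) (A n) setT) i (u n)].

Definition endo_subspace (g : set endo) : Prop :=
  g (fun n => 0) /\
  forall (c : R) (u v : endo), g u -> g v -> g (fun n => c *: u n + v n).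

(** The space g_n of n-th components of the elements of g *)
Definition component (g : set endo) (n : natbar) :
  set (germ (A n) -> germ (A n)) := [set u n | u in g].

(** rho(alpha)_n (u) = u (r_n a + alpha_n) *)
Definition rho (a : germ (A (Some 0%N))) (alpha : forall n, germ (A n))
  (n : natbar) (u : germ (A n) -> germ (A n)) : germ (A n) :=
  u (res A (Some 0%N) n a + alpha n).

(** w_n r_n w_(n-1) r_(n-1) ... r_1 w_0 : E_0 -> E_n *)
Fixpoint iter_prod (w : forall n : nat, germ (A (Some n)) -> germ (A (Some n)))
  (n : nat) (x : germ (A (Some 0%N))) : germ (A (Some n)) :=
  match n with
  | 0%N => w 0%N x
  | n'.+1 => w n'.+1 (res A (Some n') (Some n'.+1) (iter_prod w n' x))
  end.

End Subspaces.

Arguments filtration_family {R S} A k n.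
Arguments tamed1_filtration {R S} A i.
Arguments rho {R S A} a alpha n u.
Arguments component {R S A} g n _.

(* Main.v *)
(* Newton iteration with a fixed parameter: let alpha be the F-part of b.  From
   a_0 + alpha_0 + beta_0 = a + b, put u_n = j(alpha)(- beta_n) and let
   beta_(n+1) be the restriction of e^(u_n) (a + alpha + beta_n) - (a + alpha),
   which stays in G by closedness.  The new error consists of terms quadratic
   in beta_n and of the defect of the quasi-inverse, which is harmonic of order
   2^n.  On the levels s = e^-y these are compared through
     |beta_n|_s <= exp (- mu' x - nu_n (y - x_n))   for y >= x_n,
   where nu_n - V doubles at each step, as does the harmonic exponent 2^n, and
   the increments of x_n are summable because the tame constants are
   log-summable.  For y beyond the limit of x_n the u_n decay like exp (- 2^n);
   hence the product of the exponentials converges, and since beta_n tends to 0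
   the limit sends a + b to a + alpha. *)
Require Import Defs.
From mathcomp Require Import all_boot all_order all_algebra.
From mathcomp Require Import all_classical all_reals all_analysis.
From mathcomp Require Import ring lra.

Set Implicit Arguments.
Unset Strict Implicit.
Unset Printing Implicit Defensive.

Import Order.TTheory GRing.Theory Num.Theory.
Import numFieldNormedType.Exports.

Local Open Scope classical_set_scope.
Local Open Scope ring_scope.

(** * Norms of germs *)

(** In the variable y = -ln s all losses are additive: a factor (t - s)^-k costs k times the
    logarithm of the gap, a harmonic factor (s / t)^(2^n) is a slope 2^n, and the bound on beta_n is
    affine in y with slope - nu_n from x_n on. Squaring doubles the slope but pays twice for the k
    of [j] and the 1 of a 1-bounded morphism, so that nu_n has to exceed 2 k + 2. The value used is
    V = K + k with K = k + l + m + 2: a bound of order V on beta_n leaves, after the loss k, the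
    order K demanded of u_n. Condition C says exactly that mu > V. Half of mu - V, called [kap],
    starts the growth of nu_n; the other half absorbs constants. The slope may not exceed the
    harmonic exponent 2^n, which rules out starting from V + kap at small n. The induction therefore
    begins at some n0. This costs nothing, because every beta_n already has order mu as an element
    of M, and finitely many steps need no uniformity. *)

Lemma cvg_half (R : realType) : (fun n => 2^-1 ^+ n) @ \oo --> (0 : R).
Proof. by apply: cvg_expr; rewrite ger0_norm; lra. Qed.

Section Gle.
Variables (R : realType) (S : R) (E : scaled S).
Implicit Types (x y : germ E) (t s c e : R).

(** A finite bound forces t to lie in ]0, S[ and x to have a representative in E_t, so this
    predicate carries both the estimate and the membership. *)
Definition gle t x c : Prop := (germ_norm t x <= c%:E)%E.

Lemma germ_norm_ge0 t x : (0 <= germ_norm t x)%E.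
Proof. by apply: le_ereal_inf_tmp => _ /= [y _ <-]; rewrite lee_fin. Qed.

Lemma germ_norm_cases t x : germ_norm t x = +oo%E \/
  exists (ht : 0 < t < S) (y : lv E t), germ_of ht y = x.
Proof.
case: (pselect (exists (ht : 0 < t < S) (y : lv E t), germ_of ht y = x)) => h.
  by right.
left; rewrite /germ_norm (_ : [set y | _] = set0) ?image_set0 ?ereal_inf0//.
by apply/seteqP; split=> // y [ht hy]; case: h; exists ht, y.
Qed.

Lemma gleP t (ht : 0 < t < S) x c :
  gle t x c <-> exists2 y : lv E t, germ_of ht y = x & `|y| <= c.
Proof.
split; last by case=> y <- yc; rewrite /gle germ_norm_germ_of lee_fin.
rewrite /gle; case: (germ_norm_cases t x) => [-> //|[ht' [y <-]]].
rewrite germ_norm_germ_of lee_fin => yc; exists y => //.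
by rewrite (Prop_irrelevance ht ht').
Qed.

Lemma gle_of t (ht : 0 < t < S) (y : lv E t) c :
  gle t (germ_of ht y) c <-> `|y| <= c.
Proof. by rewrite /gle germ_norm_germ_of lee_fin. Qed.

Lemma gle_level t x c : gle t x c -> 0 < t < S.
Proof. by rewrite /gle; case: (germ_norm_cases t x) => [->//|[]]. Qed.

Lemma gle_ge0 t x c : gle t x c -> 0 <= c.
Proof. by move=> h; rewrite -lee_fin (le_trans (germ_norm_ge0 t x) h). Qed.

Lemma gleW t x c c' : c <= c' -> gle t x c -> gle t x c'.
Proof. by rewrite /gle => cc /le_trans; apply; rewrite lee_fin. Qed.

Lemma gle_lvl t s x c : 0 < s -> s <= t -> gle t x c -> gle s x c.
Proof.
move=> s0 st h; have ht := gle_level h.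
move/(gleP ht): h => [y <- yc].
have hs : 0 < s < S by rewrite s0 (le_lt_trans st)//; case/andP: ht.
rewrite -(germ_of_lvmap ht hs)// gle_of.
by apply: le_trans yc; apply: lvmap_norm => //; case/andP: ht.
Qed.

Lemma gleD t x y c e : gle t x c -> gle t y e -> gle t (x + y) (c + e).
Proof.
move=> h h'; have ht := gle_level h.
move/(gleP ht): h => [a <- ac]; move/(gleP ht): h' => [b <- be].
by rewrite -linearD gle_of (le_trans (ler_normD _ _))// lerD.
Qed.

Lemma gleZ t x c (l : R) : gle t x c -> gle t (l *: x) (`|l| * c).
Proof.
move=> h; have ht := gle_level h; move/(gleP ht): h => [a <- ac].
by rewrite -linearZ gle_of normrZ ler_wpM2l.
Qed.

Lemma gleN t x c : gle t x c -> gle t (- x) c.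
Proof. by move/(gleZ (-1)); rewrite scaleN1r normrN1 mul1r. Qed.

Lemma gleB t x y c e : gle t x c -> gle t y e -> gle t (x - y) (c + e).
Proof. by move=> h /gleN; apply: gleD. Qed.

Lemma gle0 t : 0 < t < S -> gle t 0 0.
Proof.
by move=> ht; rewrite -(linear0 (germ_of ht)) gle_of normr0.
Qed.

Lemma gle_ex x : exists t c, gle t x c.
Proof.
have [t [ht [y ->]]] := germ_of_surj x.
by exists t, `|y|; rewrite gle_of.
Qed.

Lemma gle_eq0 t x : (forall e, 0 < e -> gle t x e) -> x = 0.
Proof.
move=> h; have ht := gle_level (h 1 ltr01).
have /(gleP ht)[y yx _] := h 1 ltr01.
suff y0 : y = 0 by rewrite -yx y0 linear0.
apply/eqP; rewrite -normr_le0; apply/ler_addgt0Pr => e e0.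
by rewrite add0r; have := h e e0; rewrite -yx gle_of.
Qed.

Lemma gle_small t x c (a : R^nat) : a @ \oo --> 0 ->
  (forall n, gle t x (c * a n)) -> x = 0.
Proof.
move=> a0 h; apply: (@gle_eq0 t) => e e0.
have /cvgrPdist_lt /(_ e e0) : (fun n => c * a n) @ \oo --> c * 0 by exact: cvgMr.
rewrite mulr0 => -[N _ /(_ N (leqnn N))] /=; rewrite sub0r normrN => hN.
exact: gleW (le_trans (ler_norm _) (ltW hN)) (h N).
Qed.

Lemma gle_sum t (x : nat -> germ E) (c : R^nat) N : 0 < t < S ->
  (forall n, (n < N)%N -> gle t (x n) (c n)) ->
  gle t (\sum_(n < N) x n) (\sum_(n < N) c n).
Proof.
move=> ht; elim: N => [|N IH] h; first by rewrite !big_ord0; exact: gle0.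
rewrite !big_ord_recr /=; apply: gleD; last exact: h.
by apply: IH => n nN; apply: h; exact: ltnW.
Qed.

(** Only the increments are required to lie in E_t: the limit is [x 0] plus the sum of a series in
    the Banach space E_t. The bound q <= 1/2 turns 1 / (1 - q) into 2. *)
Lemma gle_complete t (x : nat -> germ E) c q :
  0 <= q -> q <= 2^-1 ->
  (forall n, gle t (x n.+1 - x n) (c * q ^+ n)) ->
  exists y, forall n, gle t (y - x n) (2 * c * q ^+ n).
Proof.
move=> q0 q2 h; have ht := gle_level (h 0%N).
have c0 : 0 <= c by have := gle_ge0 (h 0%N); rewrite expr0 mulr1.
have h' : forall n, {z : lv E t | germ_of ht z = x n.+1 - x n /\ `|z| <= c * q ^+ n}.
  by move=> n; apply: cid; have /(gleP ht)[z] := h n; exists z.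
pose z n := projT1 (h' n).
have zx n : germ_of ht (z n) = x n.+1 - x n by case: (projT2 (h' n)).
have zc n : `|z n| <= c * q ^+ n by case: (projT2 (h' n)).
pose p n := \sum_(i < n) z i.
have px n : germ_of ht (p n) = x n - x 0%N.
  elim: n => [|n IH]; first by rewrite /p big_ord0 linear0 subrr.
  by rewrite /p big_ord_recr linearD /= -/(p n) IH zx addrC addrA subrK.
(* The factor 1 - 2^-i makes the induction on i close. *)
have pd n i : `|p (n + i)%N - p n| <= 2 * c * q ^+ n * (1 - 2^-1 ^+ i).
  elim: i => [|i IH]; first by rewrite addn0 subrr normr0 expr0 subrr mulr0.
  rewrite addnS /p big_ord_recr /= -/(p _) -/(p n) addrAC.
  apply: le_trans (ler_normD _ _) _.
  have h1 : `|z (n + i)%N| <= c * q ^+ n * 2^-1 ^+ i.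
    apply: le_trans (zc _) _; rewrite exprD mulrA ler_wpM2l//.
      by rewrite mulr_ge0// exprn_ge0.
    by rewrite lerXn2r// nnegrE// invr_ge0.
  apply: le_trans (lerD IH h1) _; rewrite exprS.
  rewrite le_eqVlt; apply/orP; left; apply/eqP.
  by set a := 2^-1 ^+ i; field.
have pd2 n i : (n <= i)%N -> `|p i - p n| <= 2 * c * q ^+ n.
  move=> ni; rewrite -(subnKC ni); apply: le_trans (pd _ _) _.
  rewrite -[leRHS]mulr1; apply: ler_wpM2l; first by rewrite !mulr_ge0// exprn_ge0.
  by rewrite lerBlDr lerDl exprn_ge0// invr_ge0.
have q1 : `|q| < 1 by rewrite ger0_norm//; apply: le_lt_trans q2 _; lra.
have cq : (fun n => 2 * c * q ^+ n) @ \oo --> (0 : R).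
  by rewrite -(mulr0 (2 * c)); apply: cvgMr; exact: cvg_expr.
have pc : cvgn p.
  apply/cauchy_cvgP/cauchy_exP => e e0.
  have /cvgrPdist_lt /(_ e e0) [N _ /(_ N (leqnn N))] /= := cq.
  rewrite sub0r normrN => hN; exists (p N); near=> i.
  rewrite -ball_normE /= distrC; apply: le_lt_trans (le_lt_trans (ler_norm _) hN).
  by apply: pd2; near: i; exists N.
exists (x 0%N + germ_of ht (limn p)) => n.
have -> : x 0%N + germ_of ht (limn p) - x n = germ_of ht (limn p - p n).
  by rewrite linearB /= px opprB addrCA addrA.
rewrite gle_of.
have pcn : (fun i => `|p i - p n|) @ \oo --> `|limn p - p n|.
  by apply: cvg_norm; apply: cvgB => //; exact: cvg_cst.
apply: (cvgr_to_le pcn).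
by near=> i; apply: pd2; near: i; exists n.
Unshelve. all: by end_near. Qed.

(** The level is left free: a germ with zero norm at one level is zero, so limits obtained at
    different levels coincide. *)
Definition geolim (f : nat -> germ E) : set (germ E) :=
  [set y | exists s c, forall N, gle s (y - f N) (c * 2^-1 ^+ N)].

Lemma geolim_unique f y y' : geolim f y -> geolim f y' -> y = y'.
Proof.
move=> [s [c h]] [s' [c' h']]; apply/eqP; rewrite -subr_eq0; apply/eqP.
have /andP[s0 _] := gle_level (h 0%N); have /andP[s'0 _] := gle_level (h' 0%N).
apply: (@gle_small (Num.min s s') _ (c + c') (fun n => 2^-1 ^+ n)).
  exact: cvg_half.
move=> N; have -> : y - y' = (y - f N) - (y' - f N) by rewrite opprB addrA subrK.
rewrite mulrDl; apply: gleB; [apply: gle_lvl (h N)|apply: gle_lvl (h' N)];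
  by rewrite ?lt_min ?s0 ?ge_min ?lexx ?orbT.
Qed.

Lemma geolim_linear f f' y y' (a : R) : geolim f y -> geolim f' y' ->
  geolim (fun N => a *: f N + f' N) (a *: y + y').
Proof.
move=> [s [c h]] [s' [c' h']].
have /andP[s0 _] := gle_level (h 0%N); have /andP[s'0 _] := gle_level (h' 0%N).
exists (Num.min s s'), (`|a| * c + c') => N.
have -> : a *: y + y' - (a *: f N + f' N) = a *: (y - f N) + (y' - f' N).
  by rewrite scalerBr opprD addrACA.
rewrite mulrDl -mulrA; apply: gleD; first apply: gleZ;
 [apply: gle_lvl (h N)|apply: gle_lvl (h' N)];
  by rewrite ?lt_min ?s0 ?ge_min ?lexx ?orbT.
Qed.

Lemma gle_closed t (ht : 0 < t < S) (y : lv E t) (B : set (germ E)) :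
  (forall e, 0 < e -> exists2 x, B x & gle t (germ_of ht y - x) e) ->
  closure (germ_of ht @^-1` B) y.
Proof.
move=> h B'; rewrite -nbhs_ballE => -[e /= e0 eB'].
have e20 : 0 < e / 2 by rewrite divr_gt0.
have [x Bx] := h _ e20.
move=> /(gleP ht)[z zy ze]; exists (y - z); split => /=.
  by rewrite linearB /= zy opprB addrCA subrr addr0.
apply: eB'; rewrite -ball_normE /= opprB addrCA subrr addr0.
by apply: le_lt_trans ze _; rewrite ltr_pdivrMr// ltr_pMr// ltr1n.
Qed.

End Gle.

(** * Exponentials of 1-bounded morphisms *)

Section Exponential.
Variables (R : realType) (S : R) (E : scaled S).
Implicit Types (x y z : germ E) (t s c e q C : R) (u : germ E -> germ E).

Lemma gle_norm (F : scaled S) t s (x : germ E) (y : germ F) K : 0 < K -> 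
  (forall c, gle t x c -> gle s y (K * c)) ->
  (germ_norm s y <= K%:E * germ_norm t x)%E.
Proof.
move=> K0 h; case: (germ_norm_cases t x) => [->|[ht [x' hx]]].
  by rewrite gt0_muley ?lte_fin// leey.
by rewrite -hx germ_norm_germ_of -EFinM; apply: h; rewrite -hx gle_of.
Qed.

Lemma norm_gle (F : scaled S) t s (x : germ E) (y : germ F) K c : 0 < K ->
  (germ_norm s y <= K%:E * germ_norm t x)%E -> gle t x c -> gle s y (K * c).
Proof.
move=> K0 h xc; apply: le_trans h _; rewrite EFinM.
by apply: lee_wpmul2l => //; rewrite lee_fin ltW.
Qed.

Lemma gle_limit t x c : (forall e, 0 < e -> gle t x (c + e)) -> gle t x c.
Proof.
move=> h; have ht := gle_level (h 1 ltr01).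
have /(gleP ht)[y yx _] := h 1 ltr01.
rewrite -yx gle_of; apply/ler_addgt0Pr => e /h.
by rewrite -yx gle_of.
Qed.

Lemma gle_limit_geom t x c b : (forall N, gle t x (c + b * 2^-1 ^+ N)) -> gle t x c.
Proof.
move=> h; apply: gle_limit => e e0.
have : (fun N => b * 2^-1 ^+ N) @ \oo --> b * 0.
  by apply: cvgMr; exact: cvg_half.
move=> /cvgrPdist_lt /(_ e e0)[N _ /(_ N (leqnn N))] /=.
rewrite mulr0 sub0r normrN => hN; apply: gleW (h N).
by rewrite lerD2l (le_trans (ler_norm _))// ltW.
Qed.

Definition bnd1 (tau C : R) u := forall s t, 0 < s -> s < t -> t <= tau ->
  forall x c, gle t x c -> gle s (u x) (C / (t - s) * c).

Lemma bnd1W tau tau' C C' u : tau' <= tau -> C <= C' -> bnd1 tau C u -> bnd1 tau' C' u.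
Proof.
move=> tt CC h s t s0 st tt' x c xc; apply: gleW (h s t s0 st (le_trans tt' tt) x c xc).
apply: ler_wpM2r; first exact: gle_ge0 xc.
by apply: ler_wpM2r => //; rewrite invr_ge0 subr_ge0 ltW.
Qed.

Lemma bounded_by_bnd1 tau C u : 0 < C ->
  bounded_by (full_scale E) (full_scale E) 1 tau C u <-> bnd1 tau C u.
Proof.
move=> C0; split=> h s t s0 st tt.
  move=> x c; apply: norm_gle; first by rewrite divr_gt0// subr_gt0.
  have := h s t s0 (ltW st) tt (or_introl st) x I.
  by rewrite powRr1 ?subr_ge0// ltW.
case=> [st'|/eqP]; last by rewrite oner_eq0.
move=> x _; rewrite powRr1 ?subr_ge0//; apply: gle_norm.
  by rewrite divr_gt0// subr_gt0.
by move=> c; apply: h.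
Qed.

Lemma expR1_gt1 : 1 < expR (1 : R).
Proof. by rewrite expR_gt1. Qed.

(* The infimum defining [Ck] need not be attained a priori; the factor [e] in
   [Nk] leaves room. *)
Lemma Nk_bounded (X Y : nscale R) k tau c (v : X -> Y) : 0 < c ->
  (Nk X Y k tau v <= c%:E)%E -> exists2 C, 0 < C <= c & bounded_by X Y k tau C v.
Proof.
move=> c0 h; have e1 := expR1_gt1; have e0 : 0 < expR (1 : R) := expR_gt0 _.
have : (Ck k tau v < c%:E)%E.
  rewrite ltNge; apply/negP => h'; move: h; apply/negP; rewrite -ltNge /Nk.
  apply: lt_le_trans (_ : ((expR 1)%:E * c%:E <= _)%E).
    by rewrite -EFinM lte_fin ltr_pMl.
  by apply: lee_wpmul2l => //; rewrite lee_fin ltW.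
by move=> /ereal_inf_lt[_ [C [C0 hC] <-]]; rewrite lte_fin => /ltW Cc; exists C; rewrite ?C0.
Qed.

Lemma bounded_Nk (X Y : nscale R) k tau C (v : X -> Y) : 0 < C ->
  bounded_by X Y k tau C v -> (Nk X Y k tau v <= (expR 1 * C)%:E)%E.
Proof.
move=> C0 h; rewrite /Nk EFinM; apply: lee_wpmul2l.
  by rewrite lee_fin ltW// expR_gt0.
by apply: ereal_inf_lbound; exists C.
Qed.

Lemma Nk_bnd1 tau c u : 0 < c ->
  (Nk (full_scale E) (full_scale E) 1 tau u <= c%:E)%E -> bnd1 tau c u.
Proof.
move=> c0 /(Nk_bounded c0)[C /andP[C0 Cc]] /(bounded_by_bnd1 _ _ C0).
exact: bnd1W.
Qed.

Lemma bnd1_Nk tau C u : 0 < C -> bnd1 tau C u ->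
  (Nk (full_scale E) (full_scale E) 1 tau u <= (expR 1 * C)%:E)%E.
Proof. by move=> C0 /(bounded_by_bnd1 _ _ C0); apply: bounded_Nk. Qed.

(** The interval from s to t is cut into n equal steps, one for each application of u. *)
Lemma iter_bnd1 tau C u s t x c n : bnd1 tau C u -> 0 < s -> s < t -> t <= tau ->
  gle t x c -> gle s (iter n u x) ((C * n%:R / (t - s)) ^+ n * c).
Proof.
move=> h s0 st tt xc; case: n => [|n].
  by rewrite expr0 mul1r; apply: gle_lvl xc => //; exact: ltW.
have n0 : 0 < n.+1%:R :> R by rewrite ltr0n.
set D := (t - s) / n.+1%:R.
have D0 : 0 < D by rewrite divr_gt0// subr_gt0.
have DE : D * n.+1%:R = t - s by rewrite /D divfK// gt_eqF.
have main i : (i <= n.+1)%N ->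
  gle (t - D * i%:R) (iter i u x) ((C * n.+1%:R / (t - s)) ^+ i * c).
  elim: i => [|i IH] iN; first by rewrite mulr0 subr0 expr0 mul1r.
  rewrite exprS -mulrA iterS.
  have {1}-> : C * n.+1%:R / (t - s) = C / ((t - D * i%:R) - (t - D * i.+1%:R)).
    rewrite -DE -[i.+1%:R]natr1 (_ : _ - _ = D); last by ring.
    by rewrite -mulf_div divff ?gt_eqF// mulr1.
  have iN' : D * i.+1%:R <= D * n.+1%:R by rewrite ler_wpM2l ?ler_nat// ltW.
  apply: h (IH (ltnW iN)).
  - by apply: lt_le_trans s0 _; rewrite lerBrDl -lerBrDr -DE.
  - by rewrite ltrD2l ltrN2 ltr_pM2l// ltr_nat.
  - by apply: le_trans tt; rewrite gerBl mulr_ge0// ltW.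
by have := main n.+1 (leqnn _); rewrite DE subKr.
Qed.

(** Induction on n with (1 + 1/n)^n <= e. It compensates the n^n of [iter_bnd1] by the factorial, at
    the price of the constant e. *)
Lemma expn_le_fact n : n%:R ^+ n <= n`!%:R * expR (1 : R) ^+ n.
Proof.
elim: n => [|n IH]; first by rewrite !expr0 fact0 mulr1.
case: n IH => [_|n IH].
  by rewrite !expr1 mul1r -expR0 ler_expR.
have n0 : 0 < n.+1%:R :> R by rewrite ltr0n.
rewrite exprS factS natrM -mulrA; apply: ler_wpM2l; first by rewrite ler0n.
have -> : n.+2%:R = n.+1%:R * (1 + n.+1%:R^-1) :> R.
  by rewrite -natr1; field; rewrite gt_eqF.
rewrite exprMn [expR 1 ^+ _]exprS mulrCA [leRHS]mulrC.
apply: ler_pM IH _.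
- by rewrite exprn_ge0// ler0n.
- by rewrite exprn_ge0// addr_ge0// invr_ge0 ler0n.
have -> : expR (1 : R) = expR n.+1%:R^-1 ^+ n.+1.
  by rewrite -expRM_natl mulfV// gt_eqF.
by rewrite lerXn2r ?nnegrE ?expR_ge0 ?expR_ge1Dx// addr_ge0// invr_ge0 ler0n.
Qed.

Lemma exp_term_bnd1 tau C u s t x c n : 0 <= C -> bnd1 tau C u ->
  0 < s -> s < t -> t <= tau -> gle t x c ->
  gle s ((n`!%:R)^-1 *: iter n u x) ((expR 1 * C / (t - s)) ^+ n * c).
Proof.
move=> C0 h s0 st tt xc; have := gleZ (n`!%:R)^-1 (iter_bnd1 n h s0 st tt xc).
apply: gleW; rewrite mulrA; apply: ler_wpM2r; first exact: gle_ge0 xc.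
have f0 : 0 < n`!%:R :> R by rewrite ltr0n fact_gt0.
rewrite ger0_norm ?invr_ge0 ?ler0n// ler_pdivrMl//.
rewrite [C * n%:R]mulrC -!mulrA; set a := C / (t - s).
have a0 : 0 <= a by rewrite divr_ge0// subr_ge0 ltW.
move: (a) a0 => a' a0'; rewrite !exprMn mulrA; apply: ler_wpM2r (expn_le_fact n).
by rewrite exprn_ge0.
Qed.

Definition exp_part u N x : germ E := \sum_(j < N) (j`!%:R : R)^-1 *: iter j u x.

Definition exp_limit u x : set (germ E) := geolim (fun N => exp_part u N x).

(** The default 0 is taken where the series has no limit at a geometric rate; [expm_limit] excludes
    this for [expable] morphisms. *)
Definition expm u x : germ E := xget 0 (exp_limit u x).

(** Stated for every N because N = 0 gives the norm of the exponential, and N = 1, 2 the first and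
    second order remainders of the Newton step. *)
Lemma expm_est tau C u s t x c : 0 <= C -> bnd1 tau C u -> 0 < s -> s < t -> t <= tau ->
  expR 1 * C / (t - s) <= 2^-1 -> gle t x c ->
  exp_limit u x (expm u x) /\
  forall N, gle s (expm u x - exp_part u N x)
    (2 * c * (expR 1 * C / (t - s)) ^+ N).
Proof.
move=> C0 h s0 st tt q2 xc; set q := expR 1 * C / (t - s) in q2 *.
have c0 := gle_ge0 xc.
have q0 : 0 <= q by rewrite divr_ge0 ?mulr_ge0 ?expR_ge0// subr_ge0 ltW.
have [y yN] : exists y, forall N, gle s (y - exp_part u N x) (2 * c * q ^+ N).
  apply: gle_complete => // n; rewrite /exp_part big_ord_recr /= addrAC subrr add0r.
  by rewrite mulrC; exact: (exp_term_bnd1 n C0 h s0 st tt xc).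
have yl : exp_limit u x y.
  exists s, (2 * c) => N; apply: gleW (yN N); apply: ler_wpM2l; first by rewrite mulr_ge0.
  by apply: lerXn2r; rewrite ?nnegrE ?invr_ge0.
have -> : expm u x = y by exact: (geolim_unique (xgetPex 0 (ex_intro _ y yl)) yl).
by [].
Qed.

(** The condition defining the second step of the filtration of 1-bounded morphisms. Order 2 makes C
    t^2 / (t - t / 2) tend to 0 with t, so the series converges from level t to t / 2. *)
Definition expable u := linear u /\
  exists C tau, [/\ 0 < C, 0 < tau < S & forall s, 0 < s <= tau -> bnd1 s (C * s ^+ 2) u].

Lemma expable_small u : expable u -> exists2 tau, 0 < tau < S &
  forall t, 0 < t <= tau -> exists C, [/\ 0 <= C, bnd1 t C u &
    expR 1 * C / (t - t / 2) <= 2^-1].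
Proof.
case=> lu [C [tau [C0 /andP[tau0 tauS] h]]].
have e0 : 0 < expR (1 : R) := expR_gt0 _.
have A0 : 0 < (4 * expR 1 * C)^-1 by rewrite invr_gt0 !mulr_gt0.
(* From t to t / 2 the ratio of the series is 2 e C t, which is at most 1/2 below this level. *)
exists (Num.min tau (4 * expR 1 * C)^-1).
  by rewrite lt_min tau0 A0 gt_min tauS.
move=> t /andP[t0]; rewrite le_min => /andP[tt tA].
exists (C * t ^+ 2); split; first by rewrite mulr_ge0// ?ltW// exprn_gt0.
  by apply: h; rewrite t0.
have -> : expR 1 * (C * t ^+ 2) / (t - t / 2) = t / (4 * expR 1 * C)^-1 / 2.
  rewrite invrK (_ : t - t / 2 = t / 2); last by field.
  by field; rewrite gt_eqF.
by rewrite -[leRHS]mul1r ler_pM2r ?invr_gt0// ler_pdivrMr// mul1r.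
Qed.

Lemma expm_limit u x : expable u -> exp_limit u x (expm u x).
Proof.
move=> /expable_small[tau /andP[tau0 tauS] h]; have [t [c xc]] := gle_ex x.
have /andP[t0 tS] := gle_level xc.
have t'0 : 0 < Num.min t tau by rewrite lt_min t0.
have [|C [C0 uC q]] := h (Num.min t tau); first by rewrite t'0 ge_min lexx orbT.
have xc' : gle (Num.min t tau) x c by apply: gle_lvl xc => //; rewrite ge_min lexx.
have h2 : Num.min t tau / 2 < Num.min t tau.
  by rewrite ltr_pdivrMr// ltr_pMr// ltr1n.
have h0 : 0 < Num.min t tau / 2 by rewrite divr_gt0.
by case: (expm_est C0 uC h0 h2 (lexx _) q xc').
Qed.

Lemma iter_linear u n : linear u -> linear (iter n u).
Proof.
by move=> lu; elim: n => [//|n IH] a x y; rewrite iterS IH lu.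
Qed.

Lemma exp_part_linear u N : linear u -> linear (exp_part u N).
Proof.
move=> lu a x y; rewrite /exp_part scaler_sumr -big_split /=; apply: eq_bigr => i _.
by rewrite iter_linear// scalerDr !scalerA mulrC.
Qed.

Lemma expm_linear u : expable u -> linear (expm u).
Proof.
move=> hu a x y; apply: geolim_unique (expm_limit _ hu) _.
rewrite /exp_limit (_ : (fun N => _) =
    (fun N => a *: exp_part u N x + exp_part u N y)).
  by apply: geolim_linear; exact: expm_limit.
by apply/funext => N; rewrite exp_part_linear//; exact: hu.1.
Qed.

Lemma exp_part0 u x : exp_part u 0 x = 0.
Proof. by rewrite /exp_part big_ord0. Qed.

Lemma exp_part1 u x : exp_part u 1 x = x.
Proof. by rewrite /exp_part big_ord1 fact0 invr1 scale1r. Qed.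

Lemma exp_part2 u x : exp_part u 2 x = x + u x.
Proof. by rewrite /exp_part big_ord_recr big_ord1 /= invr1 !scale1r. Qed.

Lemma expm_is_exp u : expable u -> is_exp u (expm u).
Proof.
move=> hu; have [tau /andP[tau0 tauS] h] := expable_small hu.
have key t : 0 < t < S -> exists2 s, 0 < s < S & forall x c, gle t x c ->
  forall N, gle s (expm u x - exp_part u N x) (2 * c * 2^-1 ^+ N).
  move=> /andP[t0 tS]; pose t' := Num.min t tau.
  have t'0 : 0 < t' by rewrite lt_min t0.
  have t't : t' <= t by rewrite ge_min lexx.
  have [|C [C0 uC q]] := h t'; first by rewrite t'0 ge_min lexx orbT.
  have h2 : t' / 2 < t' by rewrite ltr_pdivrMr// ltr_pMr// ltr1n.
  have h0 : 0 < t' / 2 by rewrite divr_gt0.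
  exists (t' / 2); first by rewrite h0 (lt_le_trans h2)// (le_trans t't)// ltW.
  move=> x c xc N.
  have [_ /(_ N)] := expm_est C0 uC h0 h2 (lexx _) q (gle_lvl t'0 t't xc).
  apply: gleW; apply: ler_wpM2l; first by rewrite mulr_ge0// (gle_ge0 xc).
  apply: lerXn2r; rewrite ?nnegrE ?invr_ge0// divr_ge0 ?mulr_ge0 ?expR_ge0//.
  by rewrite subr_ge0 ltW.
split.
  split; first exact: expm_linear.
  move=> t ht; have [s hs hk] := key t ht; exists s, 2; split => // x.
  apply: gle_norm => // c xc; have := hk x c xc 0%N.
  by rewrite exp_part0 subr0 expr0 mulr1.
move=> t ht; have [s hs hk] := key t ht; exists s => // e e0.
have : (fun N => 2 * 2^-1 ^+ N) @ \oo --> (2 * 0 : R).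
  by apply: cvgMr; exact: cvg_half.
move=> /cvgrPdist_lt /(_ e e0)[N _ hN]; exists N => //= n Nn x.
apply: gle_norm => // c xc; rewrite -opprB; apply: gleN.
apply: gleW (hk x c xc n); rewrite mulrAC ler_wpM2r ?(gle_ge0 xc)//.
have := hN n Nn; rewrite /= mulr0 sub0r normrN => /ltW; apply: le_trans.
exact: ler_norm.
Qed.

End Exponential.

(** * Subspaces, relative closedness and stability under exponentials *)

Section SubspaceTheory.
Variables (R : realType) (V : lmodType R) (G : set V).

Lemma subspaceD x y : Defs.subspace G -> G x -> G y -> G (x + y).
Proof. by move=> [_ h] Gx Gy; rewrite -(scale1r x); apply: h. Qed.

Lemma subspaceZ (c : R) x : Defs.subspace G -> G x -> G (c *: x).
Proof. by move=> [G0 h] Gx; rewrite -(addr0 (c *: x)); apply: h. Qed.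

Lemma subspaceN x : Defs.subspace G -> G x -> G (- x).
Proof. by rewrite -scaleN1r; apply: subspaceZ. Qed.

End SubspaceTheory.

Section ClosedInvariance.
Variables (R : realType) (S : R) (E : scaled S).
Implicit Types (x y z : germ E) (u : germ E -> germ E).

Lemma closed_in_limit (A B : set (germ E)) y (x : nat -> germ E) s c : closed_in A B ->
  A y -> (forall N, B (x N)) -> (forall N, gle s (y - x N) (c * 2^-1 ^+ N)) -> B y.
Proof.
move=> [_ h] Ay Bx hy; have [t [b yb]] := gle_ex y.
have hs := gle_level (hy 0%N); have /andP[s0 sS] := hs.
have /andP[t0 tS] := gle_level yb.
(* The differences [y - x N] lie in E_s although [y] itself may not, hence a level common to
   both. *)
pose m := Num.min s t.
have m0 : 0 < m by rewrite lt_min s0.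
have hm : 0 < m < S by rewrite m0 gt_min sS.
have mt : m <= t by rewrite ge_min lexx orbT.
have ms : m <= s by rewrite ge_min lexx.
have /(gleP hm)[y' yy' _] := gle_lvl m0 mt yb.
rewrite -yy'; apply: h; first by rewrite yy'.
apply: gle_closed => e e0.
have : (fun N => c * 2^-1 ^+ N) @ \oo --> c * 0.
  by apply: cvgMr; exact: cvg_half.
move=> /cvgrPdist_lt /(_ e e0)[N _ /(_ N (leqnn N))] /=.
rewrite mulr0 sub0r normrN => hN; exists (x N) => //; rewrite yy'.
apply: gleW (gle_lvl m0 ms (hy N)).
exact: le_trans (ler_norm _) (ltW hN).
Qed.

Lemma filtrationP (k : R) x : filtration (X := full_scale E) k x <->
  exists C tau : R, [/\ 0 < tau, 0 <= C & forall s, 0 < s <= tau -> gle s x (C * s `^ k)].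
Proof.
split=> [[_ [C [tau [tau0 h]]]]|[C [tau [tau0 C0 h]]]].
  exists C, tau; split => //; have tt : 0 < tau <= tau by rewrite tau0 lexx.
  have := gle_ge0 (h tau tt); rewrite pmulr_lge0//; exact: powR_gt0.
by split=> //; exists C, tau.
Qed.

Lemma geom_half_le2 N : \sum_(i < N) (2^-1 : R) ^+ i <= 2.
Proof.
suff -> : \sum_(i < N) (2^-1 : R) ^+ i = 2 - 2 * 2^-1 ^+ N.
  by rewrite gerBl mulr_ge0// exprn_ge0// invr_ge0.
elim: N => [|N IH]; first by rewrite big_ord0 expr0 mulr1 subrr.
by rewrite big_ord_recr /= IH exprS; set a := 2^-1 ^+ N; field.
Qed.

(* Closedness is only relative to a space of the canonical filtration, so the
   limit of the partial sums has to be bounded by [s `^ mu] first; this uses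
   the scale-invariant ratio [t - s = s]. *)
Lemma expm_sub_mem (mu : R) (M G : set (germ E)) u z : 0 <= mu -> Defs.subspace G ->
  closed_in M G -> closed_in (filtration (X := full_scale E) mu) M ->
  expable u -> (forall x, G x -> G (u x)) -> G (u z) -> G (expm u z - z).
Proof.
move=> mu0 subG clG clM hu uG Guz.
have [tau /andP[tau0 tauS] small] := expable_small hu.
have [t1 [c zc]] := gle_ex z; have /andP[t10 _] := gle_level zc.
have [Cv [t2 [t20 Cv0 hv]]] := (filtrationP _ _).1 (clM.1 _ (clG.1 _ Guz)).
pose T := Num.min tau (Num.min t1 t2).
have T0 : 0 < T by rewrite !lt_min tau0 t10.
have Ttau : T <= tau by rewrite ge_min lexx.
have Tt1 : T <= t1 by rewrite !ge_min lexx !orbT.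
have Tt2 : T <= t2 by rewrite !ge_min lexx !orbT.
(* The element z need not belong to G. Once it is subtracted, only iterates of u applied to [u z]
   remain. *)
pose w N := exp_part u N.+1 z - z.
have wE N : w N = \sum_(i < N) (i.+1`!%:R : R)^-1 *: iter i u (u z).
  rewrite /w /exp_part big_ord_recl /= fact0 invr1 scale1r addrC addKr.
  by apply: eq_bigr => i _; rewrite -iterSr /bump.
have Gw N : G (w N).
  rewrite wE; elim: N => [|N IH]; first by rewrite big_ord0; exact: subG.1.
  rewrite big_ord_recr /=; apply: subspaceD => //; apply: subspaceZ => //.
  by elim: N {IH} => [//|N IH]; rewrite iterS; apply: uG.
have est t : 0 < t -> t <= T -> gle (t / 2) (expm u z - z) (2 * (Cv * t `^ mu)) /\
    forall N, gle (t / 2) (expm u z - z - w N) (2 * c * 2^-1 ^+ N).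
  move=> t0 tT.
  have [|C [C0 uC q]] := small t; first by rewrite t0 (le_trans tT).
  have h2 : t / 2 < t by rewrite ltr_pdivrMr// ltr_pMr// ltr1n.
  have h0 : 0 < t / 2 by rewrite divr_gt0.
  have q0 : 0 <= expR 1 * C / (t - t / 2).
    by rewrite divr_ge0 ?mulr_ge0 ?expR_ge0// subr_ge0 ltW.
  have zt := gle_lvl t0 (le_trans tT Tt1) zc.
  have vt : gle t (u z) (Cv * t `^ mu) by apply: hv; rewrite t0 (le_trans tT).
  have qn N : (expR 1 * C / (t - t / 2)) ^+ N <= 2^-1 ^+ N.
    by apply: lerXn2r; rewrite ?nnegrE ?invr_ge0.
  have hN N : gle (t / 2) (expm u z - z - w N) (2 * c * 2^-1 ^+ N).
    rewrite /w opprB addrA subrK.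
    have [_ /(_ N.+1)] := expm_est C0 uC h0 h2 (lexx _) q zt.
    apply: gleW; apply: ler_wpM2l; first by rewrite mulr_ge0// (gle_ge0 zt).
    apply: le_trans (qn _) _; rewrite exprS ler_piMl// ?exprn_ge0 ?invr_ge0//.
    by rewrite invf_le1// ler1n.
  split => //; apply: (gle_limit_geom (b := 2 * c)) => N.
  rewrite -(subrK (w N) (expm u z - z)) [X in gle _ _ X]addrC; apply: gleD => //.
  rewrite wE; set B := Cv * _.
  have B0 : 0 <= B by exact: gle_ge0 vt.
  apply: (@gleW _ _ _ _ _ (\sum_(i < N) (2^-1) ^+ i * B)).
    by rewrite -mulr_suml ler_wpM2r// geom_half_le2.
  apply: (@gle_sum _ _ _ _ (fun i => (i.+1`!%:R : R)^-1 *: iter i u (u z))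
    (fun i => 2^-1 ^+ i * B)); first exact: gle_level (hN 0%N).
  move=> i _.
  have -> : (i.+1`!%:R : R)^-1 *: iter i u (u z) =
      (i.+1%:R)^-1 *: ((i`!%:R)^-1 *: iter i u (u z)).
    by rewrite scalerA factS natrM invfM.
  have := gleZ (i.+1%:R)^-1 (exp_term_bnd1 i C0 uC h0 h2 (lexx _) vt).
  apply: gleW; rewrite -/B; move: (B) B0 => b b0.
  rewrite mulrA; apply: ler_wpM2r => //; apply: le_trans (qn i); rewrite ler_piMl ?exprn_ge0//.
  by rewrite ger0_norm ?invr_ge0// invf_le1// ler1n.
have Ey : filtration (X := full_scale E) mu (expm u z - z).
  apply/filtrationP; exists (2 * (Cv * 2 `^ mu)), (T / 2).
  split; [by rewrite divr_gt0|by rewrite !mulr_ge0// powR_ge0|].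
  move=> s /andP[s0]; rewrite ler_pdivlMr// => sT.
  have s20 : 0 < s * 2 by rewrite mulr_gt0.
  have [+ _] := est _ s20 sT; rewrite mulfK//.
  by rewrite powRM// ?ltW// -!mulrA [s `^ mu * _]mulrC.
(* The same sequence is used twice: it places the limit in M, closed in the filtration, and then in
   G, closed in M. *)
have [_ hw] := est T T0 (lexx _).
have My : M (expm u z - z).
  by apply: (closed_in_limit clM Ey _ hw) => N; exact: clG.1.
exact: (closed_in_limit clG My Gw hw).
Qed.

End ClosedInvariance.

(** * Infinite products of exponentials *)

Section InfiniteProduct.
Variables (R : realType) (S : R) (E : arnold S).

Lemma res_gle : exists2 tau : R, 0 < tau < S &
  forall (i j : natbar) (x : germ (E i)) s c, lenb i j -> s <= tau ->
    gle s x c -> gle s (res E i j x) c.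
Proof.
have [tau htau h] := res_bounded E; exists tau => // i j x s c ij st xc.
have /andP[s0 _] := gle_level xc.
have := h i j ij s s s0 (lexx _) st (or_intror erefl) x I.
rewrite powRr0 divr1 => /norm_gle-/(_ c); rewrite mul1r; apply => //.
Qed.

Variable u : forall n : nat, germ (E (Some n)) -> germ (E (Some n)).
Arguments u : clear implicits.
Hypothesis u_linear : forall n, linear (u n).
Hypothesis u_small : exists2 s0 : R, 0 < s0 < S & forall n s, 0 < s <= s0 ->
  bnd1 s (s ^+ 2 * 4^-1 ^+ n) (u n).

Lemma small_expable n : expable (u n).
Proof.
split; first exact: u_linear.
have [s0 hs0 h] := u_small; exists (4^-1 ^+ n), s0; split => //.
by move=> s hs; rewrite mulrC; apply: h.
Qed.

Let y n (x : germ (E (Some 0%N))) := iter_prod (fun n => expm (u n)) n x.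
Let ry n x := res E (Some n) None (y n x).

Lemma iter_prod_linear n : linear (y n).
Proof.
have hw n' := expm_linear (small_expable n').
elim: n => [|n IH] a x x'; rewrite /y /=; first exact: hw.
by rewrite -!/(y n _) IH linearP hw.
Qed.

(* The product is controlled on the levels t / 2 * (1 + 2^-n), which decrease
   to t / 2. *)
Lemma iter_prod_est : exists2 T : R, 0 < T < S & forall t x c, t <= T -> gle t x c ->
  forall n, gle (t / 2) (ry n x) (4 * c) /\
            gle (t / 2) (ry n.+1 x - ry n x) (c * 2^-1 ^+ n).
Proof.
have [tau /andP[tau0 tauS] hr] := res_gle.
have [s0 /andP[s00 s0S] hu] := u_small.
have e0 : 0 < expR (1 : R) := expR_gt0 _.
(* The gap of the n-th step is t h n / 4. Below (32 e)^-1 the ratio of the n-th exponential series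
   is then at most h n / 8: one factor 2^-n of 4^-n pays for the gap, the other gives
   convergence. *)
pose T := Num.min (Num.min tau s0) (32 * expR 1)^-1.
have T0 : 0 < T by rewrite !lt_min tau0 s00 invr_gt0 mulr_gt0.
have Ttau : T <= tau by rewrite !ge_min lexx.
have Ts0 : T <= s0 by rewrite !ge_min lexx !orbT.
have Te : T <= (32 * expR 1)^-1 by rewrite !ge_min lexx !orbT.
exists T; first by rewrite T0 (le_lt_trans Ttau).
move=> t x c tT xc; have /andP[t0 tS] := gle_level xc.
have c0 := gle_ge0 xc.
pose h n : R := 2^-1 ^+ n.
have h0 n : 0 < h n by rewrite exprn_gt0// invr_gt0.
have h1 n : h n <= 1 by rewrite exprn_ile1// ?invr_ge0// invf_le1// ler1n.
have hS n : h n.+1 = h n / 2 by rewrite /h exprS mulrC.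
pose l n := t / 2 * (1 + h n).
have l0 n : 0 < l n by rewrite mulr_gt0 ?divr_gt0// addr_gt0.
have l_gt n : t / 2 < l n by rewrite ltr_pMr ?divr_gt0// ltrDl.
have lt n : l n <= t.
  by rewrite /l -{2}(divfK (x := 2) _ t)// ler_pM2l ?divr_gt0// -[2]/(1 + 1) lerD2l.
have lS n : l n.+1 < l n.
  by rewrite /l ltr_pM2l ?divr_gt0// ltrD2l hS ltr_pdivrMr// ltr_pMr// ltr1n.
have step n z b : gle (l n) z b ->
    gle (l n.+1) (expm (u n) z - z) (h n / 4 * b) /\
    gle (l n.+1) (expm (u n) z) ((1 + h n / 4) * b).
  move=> zb.
  have uC : bnd1 (l n) (l n ^+ 2 * 4^-1 ^+ n) (u n).
    by apply: hu; rewrite l0 (le_trans (lt n))// (le_trans tT).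
  have C0 : 0 <= l n ^+ 2 * 4^-1 ^+ n.
    by rewrite mulr_ge0// exprn_ge0// ?invr_ge0// ltW.
  have q8 : expR 1 * (l n ^+ 2 * 4^-1 ^+ n) / (l n - l n.+1) <= h n / 8.
    have -> : 4^-1 ^+ n = h n * h n.
      by rewrite /h -exprMn -invfM -natrM.
    rewrite ler_pdivrMr ?subr_gt0//.
    have -> : l n - l n.+1 = t * h n / 4 by rewrite /l hS; field.
    have : l n ^+ 2 <= t * (32 * expR 1)^-1.
      rewrite expr2; apply: ler_pM (lt n) _; [exact: ltW|exact: ltW|].
      exact: le_trans (lt n) (le_trans tT Te).
    rewrite -(ler_pM2l e0).
    have -> : expR 1 * (t * (32 * expR 1)^-1) = t / 32.
      by field; rewrite gt_eqF.
    move=> L; rewrite mulrA.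
    have -> : h n / 8 * (t * h n / 4) = t / 32 * (h n * h n) by field.
    by apply: ler_wpM2r L; rewrite mulr_ge0// ltW.
  have q2 : expR 1 * (l n ^+ 2 * 4^-1 ^+ n) / (l n - l n.+1) <= 2^-1.
    by apply: le_trans q8 _; rewrite ler_pdivrMr//; have := h1 n; lra.
  have [_ est] := expm_est C0 uC (l0 n.+1) (lS n) (lexx _) q2 zb.
  have b0 := gle_ge0 zb.
  have e1 : gle (l n.+1) (expm (u n) z - z) (h n / 4 * b).
    have := est 1%N; rewrite exp_part1 expr1; apply: gleW.
    rewrite (_ : h n / 4 * b = 2 * b * (h n / 8)); last by field.
    by apply: ler_wpM2l q8; rewrite mulr_ge0.
  split=> //; rewrite mulrDl mul1r addrC -(subrK z (expm _ _)); apply: gleD => //.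
  by apply: gle_lvl zb => //; exact: ltW.
(* The product of the factors 1 + h i / 4 is bounded by 4; the term - 2 h n makes the induction
   close, by (1 + h / 4) (4 - 4 h) <= 4 - 2 h. *)
have main n : gle (l n.+1) (y n x) ((4 - 2 * h n) * c).
  elim: n => [|n IH].
    have zb : gle (l 0%N) x c.
      apply: gle_lvl xc => //.
    have [_] := step 0%N _ _ zb; apply: gleW; apply: ler_wpM2r => //.
    by rewrite /h expr0; lra.
  have le1 : lenb (Some n) (Some n.+1) by rewrite /= leqnSn.
  have IH' := hr _ _ _ _ _ le1 (le_trans (lt n.+1) (le_trans tT Ttau)) IH.
  have [_] := step n.+1 _ _ IH'; apply: gleW; rewrite mulrA; apply: ler_wpM2r => //.
  have hp := h0 n.+1; have hle := h1 n.+1.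
  have -> : h n = 2 * h n.+1 by rewrite hS; field.
  by nra.
have sub4 n : (4 - 2 * h n) * c <= 4 * c.
  by apply: ler_wpM2r => //; have := h0 n; lra.
have t20 : 0 < t / 2 by rewrite divr_gt0.
have t2T : t / 2 <= tau.
  by apply: le_trans (le_trans tT Ttau); rewrite ler_pdivrMr// ler_peMr ?ltW// ltr1n.
move=> n; split.
  apply: hr => //; apply: gleW (sub4 n) _; apply: gle_lvl (main n) => //.
  exact: ltW.
have le1 : lenb (Some n) (Some n.+1) by rewrite /= leqnSn.
pose z := res E (Some n) (Some n.+1) (y n x).
have -> : ry n.+1 x - ry n x = res E (Some n.+1) None (expm (u n.+1) z - z).
  by rewrite linearB /= res_comp.
have hr' := hr; apply: hr' => //.
have zb : gle (l n.+1) z ((4 - 2 * h n) * c).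
  by apply: hr (main n) => //; apply: le_trans (lt _) (le_trans tT Ttau).
have [+ _] := step n.+1 _ _ zb => /(gle_lvl t20 (ltW (l_gt _))); apply: gleW.
apply: le_trans (_ : h n.+1 / 4 * (4 * c) <= _).
  by apply: ler_wpM2l (sub4 n); rewrite divr_ge0// ltW.
rewrite (_ : h n.+1 / 4 * (4 * c) = c * h n.+1); last by field.
apply: ler_wpM2l => //; rewrite hS ler_pdivrMr// ler_peMr ?ler1n//.
by rewrite ltW.
Qed.

Definition inf_prod x : germ (E None) := xget 0 (geolim (fun n => ry n x)).

Lemma inf_prod_est : exists2 T : R, 0 < T < S & forall t x c, t <= T -> gle t x c ->
  geolim (fun n => ry n x) (inf_prod x) /\
  forall n, gle (t / 2) (inf_prod x - ry n x) (2 * c * 2^-1 ^+ n).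
Proof.
have [T hT h] := iter_prod_est; exists T => // t x c tT xc.
have [z hz] : exists z, forall n, gle (t / 2) (z - ry n x) (2 * c * 2^-1 ^+ n).
  by apply: gle_complete => [||n]; rewrite ?invr_ge0//; case: (h t x c tT xc n).
have zl : geolim (fun n => ry n x) z by exists (t / 2), (2 * c).
have -> : inf_prod x = z by exact: (geolim_unique (xgetPex 0 (ex_intro _ z zl)) zl).
by [].
Qed.

Lemma inf_prod_limit x : geolim (fun n => ry n x) (inf_prod x).
Proof.
have [T /andP[T0 TS] h] := inf_prod_est; have [t [c xc]] := gle_ex x.
have /andP[t0 _] := gle_level xc.
have m0 : 0 < Num.min t T by rewrite lt_min t0.
have xc' : gle (Num.min t T) x c by apply: gle_lvl xc => //; rewrite ge_min lexx.
by case: (h (Num.min t T) x c _ xc') => //; rewrite ge_min lexx orbT.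
Qed.

Lemma inf_prod_linear : linear inf_prod.
Proof.
move=> a x x'; apply: geolim_unique (inf_prod_limit _) _.
rewrite (_ : (fun n => _) = (fun n => a *: ry n x + ry n x')).
  by apply: geolim_linear; exact: inf_prod_limit.
by apply/funext => n; rewrite /ry iter_prod_linear linearP.
Qed.

Lemma inf_prod_morphism : is_morphism inf_prod /\ cvg_mor ry inf_prod.
Proof.
have [T /andP[T0 TS] h] := inf_prod_est; have [T' /andP[T'0 T'S] h'] := iter_prod_est.
have key t : 0 < t < S -> exists2 s, 0 < s < S & forall x c, gle t x c ->
  gle s (inf_prod x) (6 * c) /\
  forall n, gle s (inf_prod x - ry n x) (2 * c * 2^-1 ^+ n).
  move=> /andP[t0 tS]; pose t' := Num.min t (Num.min T T').
  have t'0 : 0 < t' by rewrite !lt_min t0 T0.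
  have t't : t' <= t by rewrite ge_min lexx.
  have t'T : t' <= T by rewrite !ge_min lexx !orbT.
  have t'T' : t' <= T' by rewrite !ge_min lexx !orbT.
  have h2 : t' / 2 < t' by rewrite ltr_pdivrMr// ltr_pMr// ltr1n.
  exists (t' / 2).
    by rewrite divr_gt0//= (lt_trans h2)// (le_lt_trans t't).
  move=> x c /(gle_lvl t'0 t't) xc.
  have [_ hn] := h t' x c t'T xc; split => //.
  have [h4 _] := h' t' x c t'T' xc 0%N.
  have := hn 0%N; rewrite expr0 mulr1 => h2c.
  rewrite -(subrK (ry 0%N x) (inf_prod x)) (_ : 6 * c = 2 * c + 4 * c); last by ring.
  exact: gleD.
split.
  split; first exact: inf_prod_linear.
  move=> t ht; have [s hs hk] := key t ht; exists s, 6; split => // x.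
  by apply: gle_norm => // c xc; case: (hk x c xc).
move=> t ht; have [s hs hk] := key t ht; exists s => // e e0.
have : (fun N => 2 * 2^-1 ^+ N) @ \oo --> (2 * 0 : R).
  by apply: cvgMr; exact: cvg_half.
move=> /cvgrPdist_lt /(_ e e0)[N _ hN]; exists N => //= n Nn x.
apply: gle_norm => // c xc; rewrite -opprB; apply: gleN.
have [_ hkn] := hk x c xc; apply: gleW (hkn n).
rewrite mulrAC ler_wpM2r ?(gle_ge0 xc)//.
have := hN n Nn; rewrite /= mulr0 sub0r normrN => /ltW; apply: le_trans.
exact: ler_norm.
Qed.

End InfiniteProduct.

(** * One step of the iteration *)

Section NewtonStep.
Variable R : realType.

Lemma expR_powR (x k : R) : expR x `^ k = expR (k * x).
Proof. by rewrite /powR gt_eqF ?expR_gt0// expRK. Qed.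

(** From e^h >= 1 + h with h = e^-n. This shift is small enough for 2^n h to stay bounded, and large
    enough for the logarithm of the gap to lose only n, which is summable against 2^-n. *)
Lemma level_gap (n : nat) (y1 y2 : R) : y1 + expR (- n%:R) <= y2 ->
  expR (- (y2 + n%:R)) <= expR (- y1) - expR (- y2).
Proof.
move=> h; rewrite lerBrDl opprD expRD -[X in X + _]mulr1 -mulrDr.
apply: le_trans (_ : expR (- y2) * expR (expR (- n%:R)) <= _).
  by rewrite ler_pM2l ?expR_gt0// expR_ge1Dx.
by rewrite -expRD ler_expR; lra.
Qed.

Lemma level_gap_powR (n : nat) (y1 y2 k : R) : 0 <= k -> y1 + expR (- n%:R) <= y2 ->
  ((expR (- y1) - expR (- y2)) `^ k)^-1 <= expR (k * (y2 + n%:R)).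
Proof.
move=> k0 h; have g := level_gap h.
rewrite -[leRHS]invrK -expRN -mulrN -expR_powR.
rewrite lef_pV2 ?posrE ?powR_gt0 ?expR_gt0//.
  by rewrite ge0_ler_powR// ?nnegrE ?expR_ge0// (le_trans (expR_ge0 _) g).
by apply: lt_le_trans g; exact: expR_gt0.
Qed.

Lemma level_lt (y1 y2 : R) : y1 < y2 -> expR (- y2) < expR (- y1).
Proof. by rewrite ltr_expR ltrN2. Qed.

Variables (S : R) (E : scaled S) (u : germ E -> germ E) (A beta : germ E).
Variables (k d lq tau Ca : R) (n : nat).
Hypotheses (k0 : 0 <= k) (d0 : 0 <= d) (lq0 : 0 <= lq) (Ca0 : 0 <= Ca).
Hypothesis uE : expable u.
Hypothesis u_bnd : forall s t c, 0 < s -> s < t -> t <= tau -> 0 < c ->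
  gle t beta c -> bnd1 s (expR lq / (t - s) `^ k * c) u.
Hypothesis defect : forall s t c, 0 < s -> s < t -> t <= tau ->
  gle t (beta + u A) c ->
  gle s (beta + u A) ((t - s) `^ (- d) * (s / t) ^+ (2 ^ n) * c).
Hypothesis A_bnd : gle tau A Ca.

Let h : R := expR (- n%:R).

Lemma u_bnd_level y1 y2 b : expR (- y1) <= tau -> y1 + h <= y2 ->
  gle (expR (- y1)) beta (expR b) ->
  bnd1 (expR (- y2)) (expR (lq + k * (y2 + n%:R) + b)) u.
Proof.
move=> yt y12 hb; have h0 : 0 < h := expR_gt0 _.
have y12' : y1 < y2 by lra.
have := u_bnd (expR_gt0 _) (level_lt y12') yt (expR_gt0 b) hb.
apply: bnd1W => //; rewrite !expRD; apply: ler_wpM2r; first exact: expR_ge0.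
by apply: ler_wpM2l; [exact: expR_ge0|exact: level_gap_powR].
Qed.

(* e^u (A + beta) - A splits into the second-order remainder of e^u A, the
   first-order remainder of e^u beta, and the defect of the quasi-inverse. *)
Lemma newton_split : expm u (A + beta) - A =
  (expm u A - (A + u A)) + (expm u beta - beta) + (beta + u A).
Proof.
have := expm_linear uE; move=> /(_ 1 A beta); rewrite !scale1r => ->.
rewrite -[RHS]addrA (addrA (expm u beta - beta)) subrK.
by rewrite [expm u beta + u A]addrC opprD !addrA subrK addrAC.
Qed.

Variables (mux xn g nu nu' V : R).
Hypotheses (xn0 : 0 <= xn) (xn_tau : expR (- xn) <= tau).
Hypothesis beta_bnd : forall y, xn <= y ->
  gle (expR (- y)) beta (expR (- mux - nu * (y - xn))).
Hypotheses (nu0 : 0 <= nu) (nu'0 : 0 <= nu') (mux0 : 0 <= mux).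
Hypotheses (Vk : 2 * k + 2 <= V) (nuE : nu' = 2 * nu - V) (nu'n : nu' <= 2 ^+ n)
  (xn_mux : (2 * k + 2) * xn <= mux) (hg : 3 * h <= g).
(** The shift g of the base point has to absorb the constants of both kinds of error: of the
    quadratic terms through the new slope nu', of the defect through the harmonic slope 2^n. *)
Hypothesis condQ :
  ln (4 * (Ca + 1)) + 2 + 2 * lq + (2 * k + 2) * n%:R + 4 * nu * h <= nu' * g.
Hypothesis condH :
  ln (2 * (Ca + 1)) + lq + (k + 1 + d) * (xn + 3 * h + n%:R) <= 2 ^+ n * (g - 3 * h).

(** A bound on the defect at xn + 2 h that is only linear in beta suffices: between that level and y
    the harmonic inequality gains the slope 2^n >= nu'. The third h keeps the factor with exponent -
    d bounded. *)
Lemma defect_est y : xn + g <= y ->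
  gle (expR (- y)) (beta + u A) (expR (- mux - nu' * (y - xn - g)) / 2).
Proof.
move: (k0) (d0) (lq0) (Ca0) (xn0) (nu0) (nu'0) (mux0) (Vk) (nu'n) (xn_mux) (hg).
do 12 move=> ?; move=> hy; have h0 : 0 < h := expR_gt0 _.
have n0 : 0 <= n%:R :> R by rewrite ler0n.
have b0 := beta_bnd (lexx xn); rewrite subrr mulr0 subr0 in b0.
have u1 := u_bnd_level xn_tau (lexx (xn + h)) b0.
have lt2 : xn + h < xn + 2 * h by lra.
have gap2 : expR (- (xn + 2 * h + n%:R)) <= expR (- (xn + h)) - expR (- (xn + 2 * h)).
  by apply: level_gap; rewrite -/h; lra.
have A1 : gle (expR (- (xn + h))) A Ca.
  apply: gle_lvl A_bnd; rewrite ?expR_gt0//; apply: le_trans xn_tau.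
  by rewrite ler_expR; lra.
have := u1 _ _ (expR_gt0 _) (level_lt lt2) (lexx _) _ _ A1.
set K := expR (lq + k * (xn + h + n%:R) + - mux) => uA.
have K0 : 0 < K := expR_gt0 _.
pose L := lq + (k + 1) * (xn + 2 * h + n%:R) - mux.
have uA' : gle (expR (- (xn + 2 * h))) (u A) (expR L * Ca).
  apply: gleW uA; apply: ler_wpM2r => //.
  have gap0 : 0 < expR (- (xn + h)) - expR (- (xn + 2 * h)).
    by apply: lt_le_trans gap2; exact: expR_gt0.
  rewrite ler_pdivrMr//; apply: le_trans (ler_wpM2l (expR_ge0 L) gap2).
  by rewrite -expRD ler_expR /L; have := mulr_ge0 k0 (ltW h0); lra.
have bA : gle (expR (- (xn + 2 * h))) (beta + u A) (expR L * (Ca + 1)).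
  rewrite mulrDr mulr1 [X in gle _ _ X]addrC; apply: gleD => //.
  have e1 : expR (- (xn + 2 * h)) <= expR (- xn) by rewrite ler_expR; lra.
  apply: gleW (gle_lvl (expR_gt0 _) e1 b0); rewrite ler_expR /L.
  have h0' := ltW h0.
  have : 0 <= (k + 1) * (xn + 2 * h + n%:R) by rewrite mulr_ge0 ?addr_ge0 ?mulr_ge0.
  by lra.
have yy : xn + 2 * h < y by lra.
have t2 : expR (- (xn + 2 * h)) <= tau.
  by apply: le_trans xn_tau; rewrite ler_expR; lra.
apply: gleW (defect (expR_gt0 _) (level_lt yy) t2 bA).
have yh : xn + 2 * h + expR (- n%:R) <= xn + 3 * h by rewrite -/h; lra.
have hd : (expR (- (xn + 2 * h)) - expR (- y)) `^ (- d) <= expR (d * (xn + 3 * h + n%:R)).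
  rewrite powRN; apply: le_trans (level_gap_powR d0 yh).
  have gp := level_gap yh.
  have gp0 : 0 < expR (- (xn + 2 * h)) - expR (- (xn + 3 * h)).
    by apply: lt_le_trans gp; exact: expR_gt0.
  have e3 : expR (- y) <= expR (- (xn + 3 * h)) by rewrite ler_expR; lra.
  have gp1 : expR (- (xn + 2 * h)) - expR (- (xn + 3 * h)) <=
      expR (- (xn + 2 * h)) - expR (- y) by rewrite lerD2l lerN2.
  have gp2 := lt_le_trans gp0 gp1.
  rewrite lef_pV2 ?posrE ?powR_gt0//.
  by apply: ge0_ler_powR gp1; rewrite // nnegrE ltW.
have hs : (expR (- y) / expR (- (xn + 2 * h))) ^+ (2 ^ n) <=
    expR (- (2 ^+ n * (y - (xn + 3 * h)))).
  rewrite -expRN -expRD -expRM_natl ler_expR natrX.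
  have p0 : 0 <= 2 ^+ n :> R by rewrite exprn_ge0.
  by have := mulr_ge0 p0 (ltW h0); lra.
have C2 : Ca + 1 = expR (ln (2 * (Ca + 1))) / 2.
  by rewrite lnK ?posrE//; [field|lra].
rewrite C2 !mulrA; apply: ler_wpM2r => //.
apply: le_trans (_ : expR (d * (xn + 3 * h + n%:R)) *
   expR (- (2 ^+ n * (y - (xn + 3 * h)))) * expR L * expR (ln (2 * (Ca + 1))) <= _).
  do 2 (apply: ler_wpM2r; first exact: expR_ge0).
  by apply: ler_pM => //; exact: powR_ge0.
rewrite -!expRD ler_expR /L; move: condH.
have : 0 <= (2 ^+ n - nu') * (y - xn - g) by rewrite mulr_ge0//; lra.
have := mulr_ge0 (addr_ge0 k0 (@ler01 R)) (ltW h0).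
set P : R := 2 ^+ n; lra.
Qed.

(** Of the two shifts by h before y, one bounds u by beta and the other is spent on the exponential.
    The two remainders add up to at most 2 (Ca + 1) e^(2 L), half of the new bound; the defect takes
    the other half. *)
Lemma newton_step y : xn + g <= y ->
  gle (expR (- y)) (expm u (A + beta) - A) (expR (- mux - nu' * (y - xn - g))).
Proof.
move: (k0) (d0) (lq0) (Ca0) (xn0) (nu0) (nu'0) (mux0) (Vk) (nu'n) (xn_mux) (hg).
do 12 move=> ?; move=> hy; have h0 : 0 < h := expR_gt0 _.
have n0 : 0 <= n%:R :> R by rewrite ler0n.
have hy2 : xn <= y - 2 * h by lra.
have b2 := beta_bnd hy2.
have t2 : expR (- (y - 2 * h)) <= tau.
  by apply: le_trans xn_tau; rewrite ler_expR; lra.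
have y1 : y - 2 * h + h <= y - h by lra.
have := u_bnd_level t2 y1 b2.
set N := expR (lq + _ + _) => uN.
pose L := 1 + lq + (k + 1) * (y + n%:R) - mux - nu * (y - 2 * h - xn).
have lty : y - h < y by lra.
have gap : expR (- (y + n%:R)) <= expR (- (y - h)) - expR (- y).
  by apply: level_gap; rewrite -/h; lra.
have gap0 : 0 < expR (- (y - h)) - expR (- y).
  by apply: lt_le_trans gap; exact: expR_gt0.
set T := expR (- mux - nu' * (y - xn - g)).
have T0 : 0 < T := expR_gt0 _.
have T1 : T <= 1.
  have : 0 <= nu' * (y - xn - g) by rewrite mulr_ge0//; lra.
  by rewrite -expR0 ler_expR; lra.
have q_le : expR 1 * N / (expR (- (y - h)) - expR (- y)) <= expR L.
  rewrite ler_pdivrMr//; apply: le_trans (ler_wpM2l (expR_ge0 L) gap).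
  by rewrite /N -!expRD ler_expR /L; have := mulr_ge0 k0 (ltW h0); lra.
have quad : 4 * (Ca + 1) * expR L ^+ 2 <= T.
  have -> : 4 * (Ca + 1) = expR (ln (4 * (Ca + 1))) by rewrite lnK// posrE; lra.
  rewrite -expRM_natl -expRD ler_expR /L.
  have : 0 <= (V - (2 * k + 2)) * (y - xn) by rewrite mulr_ge0//; lra.
  by move: condQ; rewrite nuE; lra.
have L0 : 0 < expR L := expR_gt0 _.
(* Convergence of the exponential series follows from the quadratic estimate itself: as T <= 1, it
   gives e^(2 L) <= 1/4. *)
have L2 : expR L <= 2^-1.
  rewrite -(@ler_pXn2r _ 2)// ?nnegrE ?expR_ge0 ?invr_ge0//.
  have : 4 * (Ca + 1) * expR L ^+ 2 = 4 * expR L ^+ 2 + 4 * Ca * expR L ^+ 2 by ring.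
  have : 0 <= 4 * Ca * expR L ^+ 2 by rewrite !mulr_ge0// exprn_ge0// ltW.
  by rewrite exprVn; lra.
have q2 := le_trans q_le L2.
have q0 : 0 <= expR 1 * N / (expR (- (y - h)) - expR (- y)).
  by rewrite divr_ge0 ?mulr_ge0 ?expR_ge0// ltW.
have N0 : 0 <= N := expR_ge0 _.
have A1 : gle (expR (- (y - h))) A Ca.
  apply: gle_lvl A_bnd; rewrite ?expR_gt0//; apply: le_trans xn_tau.
  by rewrite ler_expR; lra.
have b1 : gle (expR (- (y - h))) beta (expR L).
  have e1 : expR (- (y - h)) <= expR (- (y - 2 * h)) by rewrite ler_expR; lra.
  apply: gleW (gle_lvl (expR_gt0 _) e1 b2); rewrite ler_expR /L.
  have y0 : 0 <= y by lra.
  have := mulr_ge0 (addr_ge0 k0 (@ler01 R)) (addr_ge0 y0 n0).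
  by lra.
have [_ /(_ 2%N) eA] := expm_est N0 uN (expR_gt0 _) (level_lt lty) (lexx _) q2 A1.
have [_ /(_ 1%N) eb] := expm_est N0 uN (expR_gt0 _) (level_lt lty) (lexx _) q2 b1.
rewrite exp_part2 in eA; rewrite exp_part1 expr1 in eb.
rewrite newton_split; have := gleD (gleD eA eb) (defect_est hy).
apply: gleW; rewrite -/T.
set q := expR 1 * N / _ in q_le q2 q0 *.
have : q ^+ 2 <= expR L ^+ 2 by rewrite lerXn2r// nnegrE// ltW.
have : expR L * q <= expR L ^+ 2 by rewrite expr2 ler_wpM2l// ltW.
move=> i1 i2; have : Ca * q ^+ 2 <= Ca * expR L ^+ 2 by rewrite ler_wpM2l.
by lra.
Qed.

End NewtonStep.

(** * Choice of the levels *)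

Section ScaleSequence.
Variable R : realType.

Lemma exp2_le_expR n : 2 ^+ n <= expR n%:R :> R.
Proof.
rewrite -[n%:R]mulr1 expRM_natl; apply: lerXn2r; rewrite ?nnegrE ?expR_ge0//.
by rewrite (le_trans _ (expR_ge1Dx 1))// -natr1.
Qed.

Lemma sum_succ_geom N : \sum_(i < N) (i%:R + 1) * (2^-1 : R) ^+ i <= 4.
Proof.
suff -> : \sum_(i < N) (i%:R + 1) * (2^-1 : R) ^+ i =
    4 - (2 * N%:R + 4) * 2^-1 ^+ N.
  by rewrite gerBl mulr_ge0// ?exprn_ge0 ?invr_ge0// addr_ge0// mulr_ge0.
elim: N => [|N IH]; first by rewrite big_ord0; ring.
by rewrite big_ord_recr /= IH exprS -natr1; set a := 2^-1 ^+ N; field.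
Qed.

(* The increments [xs n.+1 - xs n] are
   2^-n (4 (k + 1 + d) x + c (lq n + n + 1)), with [c] depending on [n0]. *)
Lemma scale_sequence (k d V kap lQ lH L : R) (lq : nat -> R) :
  0 <= k -> 0 <= d -> 2 * k + 2 <= V -> 0 < kap -> 0 <= lQ -> 0 <= lH ->
  (forall n, 0 <= lq n) ->
  (forall N, \sum_(i < N) (lq i + (i%:R + 1)) * 2^-1 ^+ i <= L) ->
  exists n0 : nat, exists2 X0 : R, 0 <= X0 & forall x, X0 <= x ->
  exists2 xs : nat -> R, xs n0 = x & forall n, (n0 <= n)%N ->
    let h := expR (- n%:R) in let nu i := V + kap * 2 ^+ (i - n0) in
    let g := xs n.+1 - xs n in
    [/\ x <= xs n <= 2 * x, (2 * k + 2) * xs n <= (V + kap) * x,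
        3 * h <= g /\ nu n.+1 <= 2 ^+ n,
        lQ + 2 + 2 * lq n + (2 * k + 2) * n%:R + 4 * nu n * h <= nu n.+1 * g &
        lH + lq n + (k + 1 + d) * (xs n + 3 * h + n%:R) <= 2 ^+ n * (g - 3 * h)].
Proof.
move=> k0 d0 Vk kap0 lQ0 lH0 lq0 hL.
pose hf n : R := 2^-1 ^+ n.
have hf0 n : 0 < hf n by rewrite exprn_gt0// invr_gt0.
have hfS n : hf n.+1 = hf n / 2 by rewrite /hf exprS mulrC.
have hf2 n : hf n * 2 ^+ n = 1 by rewrite /hf -exprMn mulVf// expr1n.
pose c1 := 4 * (k + 1 + d).
(* Relative margin: every [xs n] will stay between x and (1 + th) x. The two entries of the minimum
   give the bounds 2 x and (V + kap) x of the conclusion. *)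
pose th := Num.min 1 (kap / (2 * k + 2)).
have th0 : 0 < th by rewrite lt_min ltr01 divr_gt0//; lra.
have th1 : th <= 1 by rewrite ge_min lexx.
have thk : (2 * k + 2) * th <= kap.
  have kp : 0 < 2 * k + 2 by lra.
  by rewrite mulrC -ler_pdivlMr// ge_min lexx orbT.
(* The first condition bounds the sum of c1 x 2^-n over n >= n0 by th x / 2; the second keeps the
   slopes below the harmonic exponents. *)
have [n0 [n0c n0V]] : exists n0, 2 * c1 * hf n0 <= th / 2 /\ (V + 2 * kap) * hf n0 <= 1.
  pose K := 4 * c1 / th + (V + 2 * kap).
  have c10 : 0 <= c1 by rewrite /c1; lra.
  have K1 : 0 <= 4 * c1 / th by exact: divr_ge0 (mulr_ge0 (ler0n _ 4) c10) (ltW th0).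
  have : (fun n => K * hf n) @ \oo --> K * 0.
    by apply: cvgMr; exact: cvg_half.
  move=> /cvgrPdist_lt /(_ 1 ltr01)[n0 _ /(_ n0 (leqnn n0))] /=.
  rewrite mulr0 sub0r normrN => /(le_lt_trans (ler_norm _)) /ltW hK.
  have h0 := hf0 n0; exists n0; split.
    have : 4 * c1 / th * hf n0 <= 1.
      by apply: le_trans hK; apply: ler_wpM2r; [exact: ltW|rewrite /K; lra].
    rewrite mulrAC ler_pdivrMr//; lra.
  by apply: le_trans hK; apply: ler_wpM2r; [exact: ltW|rewrite /K; lra].
(* The constants of the quadratic condition are collected in c3, those of the harmonic one in c4.
   The former are divided by the slope kap 2^(n - n0) instead of 2^n, whence the factor 2^n0 / kap
   in c2. *)
pose c3 := lQ + 4 + (2 * k + 2) + 4 * (V + kap).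
pose c4 := lH + 4 + 4 * (k + 1 + d).
pose c2 := c3 * 2 ^+ n0 / kap + c4.
have c30 : 0 <= c3 by rewrite /c3; lra.
have c40 : 0 <= c4 by rewrite /c4; lra.
have p0 : 0 < 2 ^+ n0 :> R by rewrite exprn_gt0.
have c23 : c3 * 2 ^+ n0 <= c2 * kap.
  have -> : c2 * kap = c3 * 2 ^+ n0 + c4 * kap by rewrite /c2; field; rewrite gt_eqF.
  by rewrite lerDl mulr_ge0// ltW.
have c24 : c4 <= c2 by rewrite /c2 lerDr; exact: divr_ge0 (mulr_ge0 c30 (ltW p0)) (ltW kap0).
have c20 : 0 <= c2 by lra.
pose P N := \sum_(i < N) (lq i + (i%:R + 1)) * hf i.
have P0 N : 0 <= P N.
  apply: sumr_ge0 => i _; rewrite mulr_ge0 ?(ltW (hf0 _))// !addr_ge0//.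
have PL N : P N <= L by exact: hL.
have L0 : 0 <= L by apply: le_trans (PL 0%N).
(* For x beyond this value the part of the increments that does not scale with x, at most c2 L in
   total, is at most th x / 2. *)
exists n0, (2 * c2 * L / th).
  by rewrite divr_ge0 ?mulr_ge0// ltW.
move=> x; rewrite ler_pdivrMr// => hx.
have x0 : 0 <= x by rewrite -(pmulr_lge0 _ th0) (le_trans _ hx)// !mulr_ge0.
have c10 : 0 <= c1 by rewrite /c1; lra.
pose xs n := x + (2 * c1 * x * (hf n0 - hf n) + c2 * (P n - P n0)).
exists xs; first by rewrite /xs !subrr !mulr0 !addr0.
move=> n nn0 h nu g.
have h0 : 0 < h := expR_gt0 _.
have hh : h * 2 ^+ n <= 1.
  rewrite /h expRN mulrC ler_pdivrMr ?expR_gt0// mul1r; exact: exp2_le_expR.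
have t1 : 1 <= 2 ^+ n :> R by rewrite exprn_ege1// ler1n.
have h1 : h <= 1 by apply: le_trans hh; rewrite ler_peMr// ltW.
have gE : g = (c1 * x + c2 * (lq n + (n%:R + 1))) * hf n.
  by rewrite /g /xs {1}/P big_ord_recr /= -/(P n) hfS; field.
have n_ge0 : 0 <= n%:R :> R by [].
pose b := lq n + (n%:R + 1).
have b1 : 1 <= b by rewrite /b; have := lq0 n; lra.
have hfn : hf n <= hf n0.
  by apply: ler_wiXn2l; rewrite ?invr_ge0// invf_le1// ler1n.
have Pn : P n0 <= P n.
  rewrite -(subnKC nn0); elim: (n - n0)%N => [|i IH]; first by rewrite addn0.
  rewrite addnS {2}/P big_ord_recr /= -/(P (n0 + i)); apply: le_trans IH _.
  by rewrite lerDl mulr_ge0 ?(ltW (hf0 _))// !addr_ge0.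
have xs1 : x <= xs n.
  rewrite /xs lerDl; apply: addr_ge0; apply: mulr_ge0; rewrite ?subr_ge0//.
  exact: mulr_ge0 (mulr_ge0 (ler0n _ 2) c10) x0.
have xs2 : xs n <= x + th * x.
  rewrite /xs lerD2l.
  have e1 : 2 * c1 * x * (hf n0 - hf n) <= th / 2 * x.
    rewrite mulrAC; apply: ler_wpM2r => //; apply: le_trans n0c.
    apply: ler_wpM2l; first by rewrite mulr_ge0.
    by have := hf0 n; lra.
  have e2 : c2 * (P n - P n0) <= c2 * L.
    by apply: ler_wpM2l => //; have := P0 n0; have := PL n; lra.
  by lra.
clear hx n0c th0 hfn Pn P0 PL L0 hL hfS.
have g2 : 2 ^+ n * g = c1 * x + c2 * b.
  by rewrite gE mulrC -mulrA hf2 mulr1.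
have HH : lH + lq n + (k + 1 + d) * (xs n + 3 * h + n%:R) <= 2 ^+ n * (g - 3 * h).
  rewrite mulrBr g2 [2 ^+ n * (3 * h)]mulrCA [2 ^+ n * h]mulrC.
  have kd0 : 0 <= k + 1 + d by lra.
  have : (k + 1 + d) * (xs n + 3 * h + n%:R) <= (k + 1 + d) * (2 * x + 3 * b + b).
    apply: ler_wpM2l => //.
    have : th * x <= 1 * x by apply: ler_wpM2r.
    have : n%:R <= b by rewrite /b; have := lq0 n; lra.
    by lra.
  have : (k + 1 + d) * x * 2 <= c1 * x.
    by rewrite /c1; have := mulr_ge0 kd0 x0; lra.
  have : c4 * b <= c2 * b by apply: ler_wpM2r => //; lra.
  have : lq n <= b by rewrite /b; lra.
  have : lH * 1 <= lH * b by apply: ler_wpM2l.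
  by rewrite /c4; lra.
have pn : 0 < 2 ^+ n :> R by rewrite exprn_gt0.
have nuS : nu n.+1 = V + 2 * (kap * 2 ^+ (n - n0)).
  by rewrite /nu subSn// exprS; ring.
have split2 : 2 ^+ n = 2 ^+ (n - n0) * 2 ^+ n0 :> R by rewrite -exprD subnK.
have pd : 1 <= 2 ^+ (n - n0) :> R by rewrite exprn_ege1// ler1n.
have V0 : 0 <= V by lra.
split => //.
- rewrite xs1/=; apply: le_trans xs2 _.
  have : th * x <= 1 * x by apply: ler_wpM2r.
  by lra.
- apply: le_trans (_ : (2 * k + 2) * (x + th * x) <= _).
    by apply: ler_wpM2l => //; lra.
  have : (2 * k + 2) * th * x <= kap * x by apply: ler_wpM2r.
  have : (2 * k + 2) * x <= V * x by apply: ler_wpM2r.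
  by lra.
- split.
    rewrite -subr_ge0 -(pmulr_rge0 _ pn); apply: le_trans HH.
    by rewrite !addr_ge0// mulr_ge0//; lra.
  rewrite nuS split2 -[X in X + _]mulr1.
  have : V * 1 <= V * 2 ^+ (n - n0) by apply: ler_wpM2l.
  have : (V + 2 * kap) * hf n0 * 2 ^+ n0 <= 1 * 2 ^+ n0 by apply: ler_wpM2r => //; exact: ltW.
  rewrite -mulrA hf2 mulr1 mul1r => i1 i2.
  have : 2 ^+ (n - n0) * (V + 2 * kap) <= 2 ^+ (n - n0) * 2 ^+ n0.
    by apply: ler_wpM2l i1; lra.
  by lra.
- apply: le_trans (_ : c3 * b <= _).
    have : nu n * h <= V + kap.
      rewrite /nu mulrDl.
      have : V * h <= V * 1 by apply: ler_wpM2l.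
      have : kap * (2 ^+ (n - n0) * h) <= kap * 1.
        apply: ler_wpM2l; first exact: ltW.
        apply: le_trans hh; rewrite mulrC; apply: ler_wpM2l; first exact: ltW.
        by rewrite split2 ler_peMr// ?exprn_ege1// ?ler1n//; lra.
      by lra.
    have : lQ * 1 <= lQ * b by apply: ler_wpM2l.
    have : (V + kap) * 1 <= (V + kap) * b by apply: ler_wpM2l => //; lra.
    have : (2 * k + 2) * n%:R <= (2 * k + 2) * b.
      by apply: ler_wpM2l; rewrite /b; have := lq0 n; lra.
    have : lq n <= b by rewrite /b; lra.
    by rewrite /c3; lra.
  apply: le_trans (_ : kap * 2 ^+ (n - n0) * g <= _); last first.
    apply: ler_wpM2r; last by rewrite nuS; nra.
    by rewrite gE mulr_ge0 ?(ltW (hf0 _))// addr_ge0// mulr_ge0//; rewrite -/b; lra.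
  rewrite -(ler_pM2r p0) (_ : _ * g * _ = kap * (2 ^+ n * g)); last first.
    by rewrite split2; ring.
  rewrite g2.
  have : c3 * 2 ^+ n0 * b <= c2 * kap * b by apply: ler_wpM2r => //; lra.
  have := mulr_ge0 (ltW kap0) (mulr_ge0 c10 x0).
  by lra.
Qed.

End ScaleSequence.

(** * Convergence of the iteration *)

Section NewtonIteration.
Variables (R : realType) (S : R) (E : arnold S).

(** From 1/t <= x <= e^x; thresholds in y can thus be written with inverses in place of
    logarithms. *)
Lemma ge_expRN (t x : R) : 0 < t -> t^-1 <= x -> expR (- x) <= t.
Proof.
move=> t0 tx; rewrite expRN -[leRHS]invrK lef_pV2 ?posrE ?expR_gt0 ?invr_gt0//.
by apply: le_trans tx _; apply: le_trans (expR_ge1Dx x); rewrite lerDr.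
Qed.

Lemma filtration_level (F : scaled S) (mu : R) (x : germ F) : filtration (X := full_scale F) mu x ->
  exists c Y : R, [/\ 0 <= c, 0 <= Y & forall y, Y <= y -> gle (expR (- y)) x (expR (c - mu * y))].
Proof.
move=> /filtrationP[C [tau [tau0 C0 h]]]; exists (ln (C + 1)), tau^-1.
split; [by rewrite ln_ge0// lerDr|by rewrite invr_ge0 ltW|].
move=> y ty; have := h (expR (- y)); rewrite expR_gt0 ge_expRN// => /(_ isT).
apply: gleW; rewrite expR_powR mulrN expRD; apply: ler_wpM2r; first exact: expR_ge0.
by rewrite lnK ?lerDl// posrE; lra.
Qed.

Lemma finite_threshold (P : nat -> R -> Prop) (N : nat) :
  (forall n, exists2 Y : R, 0 <= Y & forall y, Y <= y -> P n y) ->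
  exists2 Y : R, 0 <= Y & forall n y, (n < N)%N -> Y <= y -> P n y.
Proof.
move=> h; elim: N => [|N [Y Y0 IH]]; first by exists 0.
have [Z Z0 hZ] := h N; exists (Y + Z); first exact: addr_ge0.
move=> n y; rewrite ltnS leq_eqVlt => /orP[/eqP ->|nN] Yy.
  by apply: hZ; lra.
by apply: IH => //; lra.
Qed.

(** After the loss k the order mu of [b0] leaves K + 2 kap, and for large y the surplus exceeds
    every constant, 2^n included. The threshold depends on n, so this serves for finitely many
    indices. *)
Lemma fixed_index_bound (F : scaled S) (b0 : germ F) (v : germ F -> germ F)
    (k mu K kap tau l : R) (n : nat) :
  0 <= k -> k + 2 <= K -> 0 < kap -> mu = K + k + 2 * kap -> 0 < tau -> 0 <= l ->
  (forall s t c, 0 < s -> s < t -> t <= tau -> 0 < c ->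
    gle t b0 c -> bnd1 s (expR l / (t - s) `^ k * c) v) ->
  filtration (X := full_scale F) mu b0 ->
  exists2 Y : R, 0 <= Y & forall y, Y <= y ->
    bnd1 (expR (- y)) (expR (- (2 + K * y + 2 ^+ n))) v.
Proof.
move=> k0 Kk kap0 muE tau0 lqn0 ub bmu.
have i1 : 0 <= tau^-1 by rewrite invr_ge0 ltW.
have [c [Z [cp Z0 hZ]]] := filtration_level bmu.
have mu0 : 0 <= mu by rewrite muE; lra.
have p0 : 0 < 2 ^+ n :> R by rewrite exprn_gt0.
have kn0 : 0 <= k * n%:R by rewrite mulr_ge0.
pose W := (2 + l + k * n%:R + c + mu + 2 ^+ n) / kap.
have W0 : 0 <= W by apply: divr_ge0 (ltW kap0); lra.
exists (1 + Z + tau^-1 + W); first by lra.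
move=> y hy.
have y1t : expR (- (y - 1)) <= tau by apply: ge_expRN => //; lra.
have y1y : y - 1 + expR (- n%:R) <= y.
  by rewrite -lerBrDl opprB addrC subrK -expR0 ler_expR oppr_le0.
have zb : gle (expR (- (y - 1))) b0 (expR (c - mu * (y - 1))) by apply: hZ; lra.
have := u_bnd_level k0 ub y1t y1y zb.
apply: bnd1W => //; rewrite ler_expR.
have Wy : W <= y by lra.
have : 2 + l + k * n%:R + c + mu + 2 ^+ n <= kap * y.
  by rewrite [leRHS]mulrC -ler_pdivrMr.
have : 0 <= kap * y by apply: mulr_ge0 (ltW kap0) _; lra.
by rewrite muE; lra.
Qed.

Variables (A beta : forall n, germ (E (Some n))).
Variable (u : forall n : nat, germ (E (Some n)) -> germ (E (Some n))).
Arguments u : clear implicits.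
Variables (k d mu K kap tau Ca L : R) (lq : nat -> R).

(** The slopes nu_n grow like 2^n, and so does the decay of [u n] at a fixed level beyond all
    [xs n]. The constant 2 in the exponent leaves room for the factor e of N^1 and for a strict
    inequality. *)
Lemma newton_iteration :
  0 <= k -> 0 <= d -> k + 2 <= K -> 0 < kap -> mu = K + k + 2 * kap ->
  0 <= Ca -> 0 < tau -> (forall n, 0 <= lq n) ->
  (forall N, \sum_(i < N) lq i * 2^-1 ^+ i <= L) ->
  (forall n, expable (u n)) ->
  (forall n s t c, 0 < s -> s < t -> t <= tau -> 0 < c ->
    gle t (beta n) c -> bnd1 s (expR (lq n) / (t - s) `^ k * c) (u n)) ->
  (forall n s t c, 0 < s -> s < t -> t <= tau ->
    gle t (beta n + u n (A n)) c ->
    gle s (beta n + u n (A n)) ((t - s) `^ (- d) * (s / t) ^+ (2 ^ n) * c)) ->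
  (forall n, gle tau (A n) Ca) ->
  (forall n, filtration (X := full_scale (E (Some n))) mu (beta n)) ->
  (forall n, beta n.+1 =
     res E (Some n) (Some n.+1) (expm (u n) (A n + beta n) - A n)) ->
  exists2 Y : R, 0 <= Y &
    (forall n y, Y <= y -> bnd1 (expR (- y)) (expR (- (2 + K * y + 2 ^+ n))) (u n)) /\
    exists n0 : nat, exists c : R, forall i,
      gle (expR (- Y)) (beta (n0 + i)%N) (c * 2^-1 ^+ i).
Proof.
move=> k0 d0 Kk kap0 muE Ca0 tau0 lq0 lqL uE u_bnd defect A_bnd beta_mu betaE.
have [taur /andP[taur0 _] hr] := res_gle E.
pose V := K + k.
have Vk : 2 * k + 2 <= V by rewrite /V; lra.
have V0 : 0 <= V by lra.
have lQ0 : 0 <= ln (4 * (Ca + 1)) by rewrite ln_ge0//; lra.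
have lH0 : 0 <= ln (2 * (Ca + 1)) by rewrite ln_ge0//; lra.
have hL N : \sum_(i < N) (lq i + (i%:R + 1)) * 2^-1 ^+ i <= L + 4.
  rewrite (eq_bigr _ (fun (i : 'I_N) _ => mulrDl (lq i) (i%:R + 1) (2^-1 ^+ i))).
  by rewrite big_split; apply: lerD; [exact: lqL|exact: sum_succ_geom].
have [n0 [X0 X00 hX]] := scale_sequence k0 d0 Vk kap0 lQ0 lH0 lq0 hL.
have [c0 [Y0 [c00 Y00 hY0]]] := filtration_level (beta_mu n0).
pose x := X0 + Y0 + tau^-1 + taur^-1 + c0 / kap.
have i1 : 0 <= tau^-1 by rewrite invr_ge0 ltW.
have i2 : 0 <= taur^-1 by rewrite invr_ge0 ltW.
have i3 : 0 <= c0 / kap by rewrite divr_ge0// ltW.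
have x0 : 0 <= x by rewrite /x; lra.
have [|xs xsn0 hxs] := hX x; first by rewrite /x; lra.
have x_tau : expR (- x) <= tau by apply: ge_expRN => //; rewrite /x; lra.
have x_taur : expR (- x) <= taur by apply: ge_expRN => //; rewrite /x; lra.
pose nu n : R := V + kap * 2 ^+ (n - n0).
have nu_ge n : kap * 2 ^+ (n - n0) <= nu n by rewrite /nu lerDr.
have nu0 n : 0 <= nu n.
  by apply: le_trans (nu_ge n); rewrite mulr_ge0 ?exprn_ge0// ltW.
pose mux := (V + kap) * x.
have mux0 : 0 <= mux by rewrite mulr_ge0//; lra.
have xs_ge n : (n0 <= n)%N -> x <= xs n by move=> /hxs[/andP[]].
have xs_le n : (n0 <= n)%N -> xs n <= 2 * x by move=> /hxs[/andP[]].
have main n : (n0 <= n)%N -> forall y, xs n <= y ->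
    gle (expR (- y)) (beta n) (expR (- mux - nu n * (y - xs n))).
  move=> nn0; rewrite -(subnKC nn0); elim: (n - n0)%N => [|i IH] y.
    (* Here mu = V + 2 kap. Since x >= c0 / kap, one kap pays for the constant c0, and the remaining
       order V + kap is nu n0. *)
    rewrite addn0 xsn0 => xy; have := hY0 y; rewrite {1}/x in xy.
    have -> : Y0 <= y by lra.
    move=> /(_ isT); apply: gleW; rewrite ler_expR /nu subnn expr0 mulr1 /mux muE -/V.
    have : c0 <= kap * y by rewrite mulrC -ler_pdivrMr//; lra.
    by lra.
  rewrite addnS; set q := (n0 + i)%N in IH *.
  have qn0 : (n0 <= q)%N by rewrite leq_addr.
  have [/andP[xq _] xqk [hg nu2] cQ cH] := hxs q qn0.
  move=> yq; rewrite betaE; apply: hr => /=; first by rewrite leqnSn.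
    apply: le_trans x_taur; rewrite ler_expR lerN2.
    by apply: le_trans yq; apply: xs_ge; exact: leqW.
  have xq_tau : expR (- xs q) <= tau.
    by apply: le_trans x_tau; rewrite ler_expR lerN2.
  have nuE : nu q.+1 = 2 * nu q - V by rewrite /nu subSn// exprS; ring.
  have := @newton_step _ _ _ (u q) (A q) (beta q) k d (lq q) tau Ca q k0 d0 (lq0 q) Ca0
    (uE q) (u_bnd q) (defect q) (A_bnd q) mux (xs q) (xs q.+1 - xs q) (nu q) (nu q.+1) V
    (le_trans x0 xq) xq_tau IH (nu0 _) (nu0 _) mux0 Vk nuE nu2 xqk hg cQ cH y.
  by rewrite addrC subrK => /(_ yq); rewrite opprB addrA subrK.
clear hX hL lQ0 lH0 X00 Y00 c00 hY0 i1 i2 i3 xsn0 hxs x_taur.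
(* The last term lets the surplus slope kap 2^(n - n0), acting on y - 1 - 2 x, outweigh everything
   else: [lq n], being one term of a bounded series, is at most L 2^n, and n is at most 2^n. *)
pose Y1 := 1 + 2 * x + (3 + L + k + V * (1 + 2 * x)) * 2 ^+ n0 / kap.
have L0 : 0 <= L by have := lqL 0%N; rewrite big_ord0.
have Y1x : 1 + 2 * x <= Y1.
  have VV : 0 <= V * (1 + 2 * x) by rewrite mulr_ge0//; lra.
  rewrite /Y1 lerDl; apply: divr_ge0 (ltW kap0); apply: mulr_ge0; first by lra.
  by rewrite exprn_ge0.
have lqn n : lq n <= L * 2 ^+ n.
  rewrite -ler_pdivrMr ?exprn_gt0// -exprVn; apply: le_trans (lqL n.+1).
  rewrite big_ord_recr /= lerDr; apply: sumr_ge0 => i _.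
  by rewrite mulr_ge0// exprn_ge0// invr_ge0.
have nn n : n%:R <= 2 ^+ n :> R by rewrite -natrX ler_nat ltnW// ltn_expl.
have large n y : (n0 <= n)%N -> Y1 <= y ->
    bnd1 (expR (- y)) (expR (- (2 + K * y + 2 ^+ n))) (u n).
  move=> nn0 Yy; have h0 : 0 < expR (- n%:R) :> R := expR_gt0 _.
  have h1 : expR (- n%:R) <= 1 :> R by rewrite -expR0 ler_expR oppr_le0.
  have xsn := xs_le n nn0; have xsn' := xs_ge n nn0.
  clear hr A_bnd betaE defect uE lqL beta_mu d0 Ca0 muE.
  pose y1 := y - expR (- n%:R).
  have y1x : xs n <= y1 by rewrite /y1; lra.
  have y1t : expR (- y1) <= tau.
    by apply: le_trans x_tau; rewrite ler_expR lerN2; lra.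
  have y1y : y1 + expR (- n%:R) <= y by rewrite /y1 subrK.
  have := u_bnd_level k0 (u_bnd n) y1t y1y (main n nn0 y1 y1x).
  apply: bnd1W => //; rewrite ler_expR.
  pose D := y - 1 - 2 * x.
  have D0 : 0 <= D by rewrite /D; lra.
  have : nu n * D <= nu n * (y1 - xs n) by apply: ler_wpM2l => //; rewrite /D /y1; lra.
  have nuD : nu n * D = V * D + kap * 2 ^+ (n - n0) * D by rewrite /nu mulrDl.
  have p0 : 0 < 2 ^+ n0 :> R by rewrite exprn_gt0.
  have pn : 1 <= 2 ^+ n :> R by rewrite exprn_ege1// ler1n.
  have split2 : 2 ^+ n = 2 ^+ (n - n0) * 2 ^+ n0 :> R by rewrite -exprD subnK.
  have kapD : (3 + L + k + V * (1 + 2 * x)) * 2 ^+ n <= kap * 2 ^+ (n - n0) * D.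
    have hD : (3 + L + k + V * (1 + 2 * x)) * 2 ^+ n0 <= D * kap.
      by rewrite -ler_pdivrMr// /D; rewrite /Y1 in Yy; lra.
    have e0 : 0 <= 2 ^+ (n - n0) :> R by rewrite exprn_ge0.
    by have := ler_wpM2l e0 hD; rewrite split2; lra.
  have : k * n%:R <= k * 2 ^+ n by apply: ler_wpM2l.
  have := lqn n; have : V * (1 + 2 * x) * 1 <= V * (1 + 2 * x) * 2 ^+ n.
    by apply: ler_wpM2l => //; rewrite mulr_ge0//; lra.
  by rewrite /D /V in nuD kapD *; lra.
have small n := fixed_index_bound n k0 Kk kap0 muE tau0 (lq0 n) (u_bnd n) (beta_mu n).
have [Y2 Y20 hY2] := finite_threshold n0 small.
exists (Y1 + Y2); first by rewrite addr_ge0//; lra.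
split.
  move=> n y hy; case: (ltnP n n0) => nn0; first by apply: hY2 => //; lra.
  by apply: large => //; lra.
(* The decay e^(- kap 2^i) is weakened to 1 / (kap 2^i), the geometric rate required of limits. *)
exists n0, kap^-1 => i.
have qn0 : (n0 <= n0 + i)%N by rewrite leq_addr.
have hx := xs_le _ qn0.
have y0 : xs (n0 + i)%N <= Y1 + Y2 by lra.
have big : kap * 2 ^+ i <= mux + nu (n0 + i)%N * (Y1 + Y2 - xs (n0 + i)%N).
  have h1 : kap * 2 ^+ i <= nu (n0 + i)%N.
    by have := nu_ge (n0 + i)%N; rewrite addKn.
  have : nu (n0 + i)%N * 1 <= nu (n0 + i)%N * (Y1 + Y2 - xs (n0 + i)%N).
    by apply: ler_wpM2l => //; lra.
  by lra.
have p0 : 0 < kap * 2 ^+ i by rewrite mulr_gt0// exprn_gt0.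
apply: gleW (main _ qn0 _ y0); rewrite -opprD exprVn -invfM.
by apply: ge_expRN; rewrite ?invr_gt0// invrK.
Qed.

End NewtonIteration.

(** * Tame bounds *)

Section TameBounds.
Variables (R : realType) (S : R).

Lemma Nk_ge0 (X Y : nscale R) k tau (v : X -> Y) : (0 <= Nk X Y k tau v)%E.
Proof.
apply: mule_ge0; first by rewrite lee_fin expR_ge0.
by apply: le_ereal_inf_tmp => _ [C [C0 _] <-]; rewrite lee_fin ltW.
Qed.

Lemma log_summable_bound (p : nat -> R) : log_summable p -> exists L : R,
  forall N, \sum_(i < N) ln (Num.max 1 (p i)) * 2^-1 ^+ i <= L.
Proof.
move=> hp; exists (limn (series (fun n => ln (Num.max 1 (p n)) / 2 ^+ n))) => N.
have -> : \sum_(i < N) ln (Num.max 1 (p i)) * 2^-1 ^+ i =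
    series (fun n => ln (Num.max 1 (p n)) / 2 ^+ n) N.
  by rewrite /series /= big_mkord; apply: eq_bigr => i _; rewrite exprVn.
apply: nondecreasing_cvgn_le => //; apply: nondecreasing_series => n _ _.
by rewrite divr_ge0 ?exprn_ge0// ln_ge0// le_max lexx.
Qed.

Lemma component_expable (E : arnold S) (g : set (endo E)) n v :
  g `<=` tamed1_filtration E 2 -> component g n v -> expable v.
Proof.
move=> hg [w gw <-]; have [[tau [_ wb _]] wf] := hg w gw.
have [[_ wl] _] := wb n; split; first by move=> c x y; apply: wl.
have [_ [C [t [t0 hC]]]] := wf n.
have S0 := scale_gt0 (E n).
exists (`|C| + 1), (Num.min t (S / 2)); split.
- by rewrite ltr_wpDl.
- by rewrite lt_min t0 divr_gt0//= gt_min ltr_pdivrMr// ltr_pMr// ltr1n orbT.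
move=> s /andP[s0]; rewrite le_min => /andP[st _].
apply: Nk_bnd1; first by rewrite mulr_gt0 ?exprn_gt0// ltr_wpDl.
have := hC s; rewrite s0 st => /(_ isT) /= /le_trans; apply.
rewrite lee_fin (powR_mulrn 2 (ltW s0)); apply: ler_wpM2r; first by rewrite exprn_ge0// ltW.
by apply: le_trans (ler_norm C) _; rewrite lerDl.
Qed.

(** The image of J is measured by N^1_s, so a k-bound for J evaluated at x is a 1-bound for [J x] up
    to level s. The exponents [lq n] are the logarithms occurring in the tame series. *)
Lemma tamed_mor_bound (E : arnold S) (G : subfamily E)
    (D : forall n, set (germ (E n) -> germ (E n))) (k : R)
    (J : forall n, germ (E n) -> germ (E n) -> germ (E n)) :
  tamed_mor S k (fun n => sub_scale (G n)) (fun n => mor_scale (D n)) J ->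
  exists tau L : R, exists lq : nat -> R, [/\ 0 < tau < S, forall n, 0 <= lq n,
    forall N, \sum_(i < N) lq i * 2^-1 ^+ i <= L,
    forall n x, G n x -> D n (J n x) &
    forall n x, G (Some n) x -> forall s t c, 0 < s -> s < t -> t <= tau -> 0 < c ->
      gle t x c -> bnd1 s (expR (lq n) / (t - s) `^ k * c) (J (Some n) x)].
Proof.
move=> [tau [tauP Jb Js]]; have [L hL] := log_summable_bound Js.
pose q n := fine (Nk (sub_scale (G (Some n))) (mor_scale (D (Some n))) k tau (J (Some n))).
exists tau, L, (fun n => ln (Num.max 1 (q n))); split => //.
- by move=> n; rewrite ln_ge0// le_max lexx.
- by move=> n x Gx; have [[h _] _] := Jb n; exact: h.
move=> n x Gx s t c s0 st tt c0 xc.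
have m0 : 0 < Num.max 1 (q n) by rewrite lt_max ltr01.
rewrite lnK ?posrE//.
have Nq : (Nk (sub_scale (G (Some n))) (mor_scale (D (Some n))) k tau (J (Some n))
    <= (Num.max 1 (q n))%:E)%E.
  have [_ hfin] := Jb (Some n).
  by rewrite -(@fineK _ (Nk _ _ _ _ _)) ?ge0_fin_numE ?Nk_ge0// lee_fin le_max lexx orbT.
have [C /andP[C0 Cq] hC] := Nk_bounded m0 Nq.
have ts0 : 0 < (t - s) `^ k by rewrite powR_gt0// subr_gt0.
have K0 : 0 < Num.max 1 (q n) / (t - s) `^ k * c by rewrite mulr_gt0// divr_gt0.
apply: Nk_bnd1 => //; have := hC s t s0 (ltW st) tt (or_introl st) x Gx.
move=> /le_trans; apply.
have h1 : (0 <= (C / (t - s) `^ k)%:E)%E by rewrite lee_fin ltW// divr_gt0.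
apply: le_trans (lee_wpmul2l h1 xc) _.
rewrite -EFinM lee_fin; apply: ler_wpM2r; first exact: ltW.
by rewrite ler_wpM2r// invr_ge0 ltW.
Qed.

(** The quasi-inverse is applied to - b because u_n corrects the error with a minus sign; its defect
    is then - z. *)
Lemma defect_bound (E : arnold S) (G : subfamily E) (a : germ (E (Some 0%N))) alpha
    (D : forall n, set (germ (E n) -> germ (E n))) (d : R)
    (J : forall n, germ (E n) -> germ (E n) -> germ (E n)) :
  right_quasi_inverse S d (fun n => mor_scale (D n)) (fun n => sub_scale (G n))
    (rho a alpha) J ->
  exists2 tau : R, 0 < tau < S & forall n b, G (Some n) (- b) ->
    let z := b + J (Some n) (- b) (res E (Some 0%N) (Some n) a + alpha (Some n)) in
    forall s t c, 0 < s -> s < t -> t <= tau -> gle t z c ->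
      gle s z ((t - s) `^ (- d) * (s / t) ^+ (2 ^ n) * c).
Proof.
move=> [tau tauP h]; exists tau => // n b Gb z s t c s0 st tt zc.
have [_ hz] := h n _ Gb.
have zE : - b - rho a alpha (Some n) (J (Some n) (- b)) = - z by rewrite /rho opprD.
have Nzc : gle t (- z) c by exact: gleN.
have := hz t; rewrite /= zE (lt_le_trans (lt_trans s0 st) (lexx _)) tt => /(_ isT).
have fin : (germ_norm t (- z)%R < +oo)%E by apply: le_lt_trans Nzc _; rewrite ltry.
move=> /(_ fin)[_ [_ /(_ s s0 st) hs]].
rewrite -[z]opprK; apply: gleN; apply: le_trans hs _; rewrite [leRHS]EFinM.
apply: lee_wpmul2l => //; rewrite lee_fin mulr_ge0 ?powR_ge0// exprn_ge0// divr_ge0// ltW//.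
exact: lt_trans st.
Qed.

End TameBounds.

(** * The Newton sequence of the given data and the limit of its exponentials *)

Lemma double_le_exp2 n : (n * 2 <= 2 ^ n)%N.
Proof. by case: n => [//|n]; rewrite mulnC expnS leq_mul2l ltn_expl. Qed.

Lemma log_summable_le1 (R : realType) (p : nat -> R) : (forall n, p n <= 1) ->
  log_summable p.
Proof.
move=> p1; rewrite /log_summable (_ : series _ = fun=> 0); first exact: is_cvg_cst.
apply/funext => n; rewrite /series /= big1// => i _.
by rewrite max_l// ln1 mul0r.
Qed.

(** Serves for the component of index +oo, which is chosen to be zero. *)
Lemma bnd1_0 (R : realType) (S : R) (E : scaled S) (tau : R) : tau < S ->
  bnd1 tau 1 (0 : germ E -> germ E).
Proof.
move=> tS s t s0 st tt x c xc; apply: gleW (gle0 _ _).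
  by rewrite mulr_ge0 ?(gle_ge0 xc)// divr_ge0// subr_ge0 ltW.
by rewrite s0 (lt_trans st)// (le_lt_trans tt).
Qed.

Theorem theorem5p5 (R : realType) (S : R) (E : arnold S)
  (mu m k l d : R) (r : nat -> R)
  (M F G : subfamily E) (g : set (endo E)) (a : germ (E (Some 0%N)))
  (j : (forall n, germ (E n)) ->
       forall n, germ (E n) -> germ (E n) -> germ (E n))
  (mu_ge0 : 0 <= mu) (m_ge0 : 0 <= m) (k_ge0 : 0 <= k) (l_ge0 : 0 <= l)
  (d_ge0 : 0 <= d)
  (M_sub : arnold_subspace M)
  (M_closed : closed_family (filtration_family E mu) M)
  (FG_split : splitting m M F G)
  (g_sub : endo_subspace g)
  (g_filt : g `<=` tamed1_filtration E 2)
  (g_G : forall u, g u -> forall n x, G n x -> G n (u n x))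
  (g_a : forall u, g u -> forall n, G n (u n (res E (Some 0%N) n a)))
  (rho_G : forall alpha, (forall n, F n (alpha n)) ->
     forall u, g u -> forall n, G n (rho a alpha n (u n)))
  (hA : forall alpha, (forall n, F n (alpha n)) ->
     tamed_mor S k (fun n => sub_scale (G n))
       (fun n => mor_scale (component g n)) (j alpha) /\
     right_quasi_inverse S d (fun n => mor_scale (component g n))
       (fun n => sub_scale (G n)) (rho a alpha) (j alpha))
  (hB : tamed_map S l (fun n => sub_scale (F n))
     (fun n => bmor_scale k (sub_scale (G n)) (mor_scale (component g n))) r j)
  (hC : mu > 2 * k + l + m + 2)
  (b : germ (E (Some 0%N))) (hb : M (Some 0%N) b)
  (A : R) (hA12 : 1 < A < 2) :
  exists u : endo E,
    [/\ is_tamed1 u,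
        forall i, component g i (u i),
        exists2 s0 : R, 0 < s0 < S & forall s : R, 0 < s -> s <= s0 ->
          forall n : nat,
            (Nk (full_scale (E (Some n))) (full_scale (E (Some n)))
               1 s (u (Some n)) <
             (s `^ (k + l + m + 2) * expR (- A ^+ n))%:E)%E &
        exists (w : forall n : nat, germ (E (Some n)) -> germ (E (Some n)))
               (gam : germ (E (Some 0%N)) -> germ (E None)),
          [/\ forall n : nat, is_exp (u (Some n)) (w n),
              is_morphism gam,
              cvg_mor (fun n x => res E (Some n) None (iter_prod w n x)) gam &
              F None (gam (a + b) - res E (Some 0%N) None a)]].
Proof.
(* K is the order demanded of N^1_s(u_n), and kap is half of mu - K - k. *)
pose K := k + l + m + 2; pose kap := (mu - (2 * k + l + m + 2)) / 2.
have kap0 : 0 < kap by rewrite /kap; lra.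
have Kk : k + 2 <= K by rewrite /K; lra.
have muE : mu = K + k + 2 * kap by rewrite /K /kap; field.
have K2 : 2 <= K by lra.
have K0 : 0 <= K by lra.
have A0 n : 0 <= A ^+ n by apply: exprn_ge0; lra.
have A2 n : A ^+ n <= 2 ^+ n by apply: lerXn2r; rewrite ?nnegrE; lra.
have [[F_sub G_sub] [F_cl G_cl] _ [pF [pG hp]]] := FG_split.
have [/(_ b hb)[Fb Gb bE] _ _] := hp (Some 0%N).
pose alpha n := res E (Some 0%N) n (pF (Some 0%N) b).
have Falpha n : F n (alpha n) by apply: F_sub.2 => //; case: n.
have [Jt Jq] := hA alpha Falpha.
have [tau1 [L [lq [/andP[tau10 _] lq0 lqL Jg Jb]]]] := tamed_mor_bound Jt.
have [tau2 /andP[tau20 _] hdef] := defect_bound Jq.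
have [taur /andP[taur0 _] hres] := res_gle E.
have [ta [ca aca]] := gle_ex a; have [tb [cb bcb]] := gle_ex (pF (Some 0%N) b).
have /andP[ta0 _] := gle_level aca; have /andP[tb0 _] := gle_level bcb.
pose An n : germ (E (Some n)) := res E (Some 0%N) (Some n) a + alpha (Some n).
pose v n (x : germ (E (Some n))) := j alpha (Some n) (- x).
pose bet : forall n : nat, germ (E (Some n)) :=
  nat_rect (fun n => germ (E (Some n))) (pG (Some 0%N) b)
    (fun n x => res E (Some n) (Some n.+1) (expm (v n x) (An n + x) - An n)).
have betS n : bet n.+1 = res E (Some n) (Some n.+1)
  (expm (v n (bet n)) (An n + bet n) - An n) by [].
have GN n x : G n x -> G n (- x) by exact: subspaceN (G_sub.1 n).
have vg n x : G (Some n) x -> component g (Some n) (v n x) by move=> Gx; apply: Jg; exact: GN.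
have vE n x : G (Some n) x -> expable (v n x).
  by move=> Gx; apply: component_expable g_filt (vg n x Gx).
have vG n x y : G (Some n) x -> G (Some n) y -> G (Some n) (v n x y).
  by move=> Gx Gy; have [w gw <-] := vg n x Gx; exact: g_G.
have vA n x : G (Some n) x -> G (Some n) (v n x (An n)).
  by move=> Gx; have [w gw <-] := vg n x Gx; exact: (rho_G alpha Falpha w gw (Some n)).
(* The new error splits into (e^v A_n - A_n) + (e^v beta_n - beta_n) + beta_n. The first two terms
   lie in G by [expm_sub_mem]: v A_n is a value of rho, and v leaves G invariant. *)
have Gbet n : G (Some n) (bet n).
  elim: n => [//|n IH]; rewrite betS; apply: G_sub.2 => /=; first exact: leqnSn.
  have mem z := @expm_sub_mem _ _ _ mu (M (Some n)) (G (Some n)) (v n (bet n)) z mu_ge0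
    (G_sub.1 _) (G_cl _) (M_closed _) (vE n _ IH) (fun x => @vG n _ x IH).
  have := expm_linear (vE n _ IH) 1 (An n) (bet n); rewrite !scale1r => ->.
  rewrite addrAC; apply: subspaceD (G_sub.1 _) (mem _ (vA n _ IH)) _.
  rewrite -(subrK (bet n) (expm _ (bet n))).
  by apply: subspaceD (G_sub.1 _) (mem _ (vG n _ _ IH IH)) IH.
pose tau := Num.min (Num.min tau1 tau2) (Num.min taur (Num.min ta tb)).
have tau0 : 0 < tau by rewrite !lt_min tau10 tau20 taur0 ta0.
have tau_1 : tau <= tau1 by rewrite !ge_min lexx.
have tau_2 : tau <= tau2 by rewrite !ge_min lexx !orbT.
have tau_r : tau <= taur by rewrite !ge_min lexx !orbT.
have tau_a : tau <= ta by rewrite !ge_min lexx !orbT.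
have tau_b : tau <= tb by rewrite !ge_min lexx !orbT.
have An_bnd n : gle tau (An n) (ca + cb).
  by apply: gleD; apply: hres => //; [exact: gle_lvl aca|exact: gle_lvl bcb].
have Ca0 := gle_ge0 (An_bnd 0%N).
have v_bnd n s t c : 0 < s -> s < t -> t <= tau -> 0 < c -> gle t (bet n) c ->
    bnd1 s (expR (lq n) / (t - s) `^ k * c) (v n (bet n)).
  move=> s0 st tt c0 xc; apply: (Jb n (- bet n) (GN _ _ (Gbet n))) => //.
    exact: le_trans tau_1.
  exact: gleN.
have v_def n s t c : 0 < s -> s < t -> t <= tau ->
    gle t (bet n + v n (bet n) (An n)) c ->
    gle s (bet n + v n (bet n) (An n)) ((t - s) `^ (- d) * (s / t) ^+ (2 ^ n) * c).
  move=> s0 st tt; apply: (hdef n (bet n) (GN _ _ (Gbet n))) => //.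
  exact: le_trans tau_2.
have bet_mu n : filtration (X := full_scale (E (Some n))) mu (bet n).
  by apply: (M_closed (Some n)).1; apply: (G_cl (Some n)).1.
have [Y Y0 [uY [n0 [cz bet0]]]] := newton_iteration k_ge0 d_ge0 Kk kap0 muE Ca0 tau0
  lq0 lqL (fun n => vE n _ (Gbet n)) v_bnd v_def An_bnd bet_mu betS.
pose un n := v n (bet n).
have S0 := scale_gt0 (E None).
pose s0 := Num.min (expR (- Y)) (S / 2).
have s00 : 0 < s0 by rewrite lt_min expR_gt0 divr_gt0.
have s0S : s0 < S by rewrite gt_min ltr_pdivrMr// ltr_pMr// ltr1n orbT.
have un_lin n : linear (un n) by case: (vE n _ (Gbet n)).
have s0y s : 0 < s -> s <= s0 -> exists2 y, s = expR (- y) & Y <= y.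
  move=> sp; rewrite le_min => /andP[sY _]; exists (- ln s); first by rewrite opprK lnK.
  by rewrite -[Y]opprK lerN2 -(expRK (- Y)) ler_ln ?posrE// expR_gt0.
have unN s n : 0 < s -> s <= s0 ->
    (Nk (full_scale (E (Some n))) (full_scale (E (Some n))) 1 s (un n) <
     (s `^ K * expR (- A ^+ n))%:E)%E.
  move=> sp ss; have [y -> Yy] := s0y s sp ss.
  apply: le_lt_trans (bnd1_Nk (expR_gt0 _) (uY n y Yy)) _.
  rewrite lte_fin expR_powR -!expRD ltr_expR.
  by have := A2 n; clear; lra.
have un_small : exists2 s1 : R, 0 < s1 < S & forall n s, 0 < s <= s1 ->
    bnd1 s (s ^+ 2 * 4^-1 ^+ n) (un n).
  exists s0; first by rewrite s00.
  move=> n s /andP[sp ss]; have [y -> Yy] := s0y s sp ss.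
  apply: bnd1W (uY n y Yy) => //.
  (* By 4^n = 2^(2 n) <= e^(2 n) <= e^(2^n). The remaining factor s^K is at most s^2, since K >= 2
     and s <= 1. *)
  have h4 : expR (- 2 ^+ n) <= 4^-1 ^+ n :> R.
    rewrite expRN exprVn lef_pV2 ?posrE ?expR_gt0 ?exprn_gt0//.
    have -> : 4 ^+ n = 2 ^+ (n * 2) :> R by rewrite mulnC exprM (_ : 2 ^+ 2 = 4 :> R)//; ring.
    apply: le_trans (exp2_le_expR _ _) _.
    by rewrite ler_expR -natrX ler_nat double_le_exp2.
  rewrite -expRM_natl.
  apply: le_trans (_ : expR (2 * - y) * expR (- 2 ^+ n) <= _).
    rewrite -expRD ler_expR.
    by have := ler_wpM2r (le_trans Y0 Yy) K2; clear; lra.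
  by apply: ler_wpM2l => //; exact: expR_ge0.
pose u : endo E := fun n => match n return germ (E n) -> germ (E n) with
  | Some i => un i | None => 0 end.
exists u; split.
- exists s0; split; first by rewrite s00.
    case=> [n|]; split.
    + by split=> // c x y _ _; apply: un_lin.
    + exact: lt_trans (unN s0 n s00 (lexx _)) (ltry _).
    + by split=> // c x y _ _; rewrite /u /= scaler0 addr0.
    + exact: le_lt_trans (bnd1_Nk ltr01 (bnd1_0 s0S)) (ltry _).
  apply: log_summable_le1 => n; have hN := unN s0 n s00 (lexx _).
  rewrite -lee_fin fineK ?ge0_fin_numE ?Nk_ge0// ?(lt_trans hN) ?ltry//.
  apply: le_trans (ltW hN) _; rewrite lee_fin.
  have [y -> Yy] := s0y s0 s00 (lexx _).
  rewrite expR_powR -expRD -expR0 ler_expR.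
  by have := mulr_ge0 K0 (le_trans Y0 Yy); have := A0 n; clear; lra.
- case=> [n|]; first exact: vg.
  by exists (fun n => 0); first exact: g_sub.1.
- by exists s0; [rewrite s00|move=> s sp ss n; exact: unN].
pose w n := expm (un n).
exists w, (inf_prod un); have [gam_mor gam_cvg] := inf_prod_morphism un_lin un_small.
split => //; first by move=> n; apply: expm_is_exp; exact: vE.
have AnS n : res E (Some n) (Some n.+1) (An n) = An n.+1.
  by rewrite /An /alpha linearD /= !res_comp /= ?leqnSn.
(* The recursion for beta is made for this: A_n restricts to A_(n+1), so the partial product,
   restricted to the next index, is A_(n+1) + beta_(n+1). *)
have iterE n : iter_prod w n (a + b) = w n (An n + bet n).
  elim: n => [|n IH]; first by rewrite {1}bE /= /An /alpha !res_id addrA.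
  rewrite [LHS]/= IH; congr (w n.+1 _); rewrite betS linearB.
  by rewrite AnS [RHS]addrC subrK.
have resE n : res E (Some n) None (w n (An n + bet n)) =
    res E (Some 0%N) None a + alpha None + res E (Some n.+1) None (bet n.+1).
  have le1 : lenb (Some n) (Some n.+1) := leqnSn n.
  rewrite betS (res_comp _ le1)// linearB /= [RHS]addrC.
  have -> : res E (Some n) None (An n) = res E (Some 0%N) None a + alpha None.
    by rewrite /An /alpha linearD /= !res_comp.
  by rewrite subrK.
suff -> : inf_prod un (a + b) - res E (Some 0%N) None a = alpha None by exact: Falpha.
apply/eqP; rewrite -subr_eq0 -addrA -opprD; apply/eqP.
have [s [c hs]] := inf_prod_limit un_small (a + b).
have /andP[sp _] := gle_level (hs 0%N).
have eY : 0 < expR (- Y) := expR_gt0 _.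
pose t := Num.min (Num.min s (expR (- Y))) taur.
have t0 : 0 < t by rewrite !lt_min sp eY taur0.
have ts : t <= s by rewrite !ge_min lexx.
have tY : t <= expR (- Y) by rewrite !ge_min lexx !orbT.
have tr : t <= taur by rewrite !ge_min lexx !orbT.
(* Both the convergence of the product and the decay of beta are geometric, the latter from index n0
   on. *)
apply: (gle_small (t := t) (c := c + cz) (@cvg_half R)) => i.
have h1 := gle_lvl t0 ts (hs (n0 + i)%N).
rewrite iterE resE in h1.
have h2 : gle t (res E (Some (n0 + i).+1) None (bet (n0 + i).+1)) (cz * 2^-1 ^+ i.+1).
  by apply: hres => //; apply: gle_lvl tY _ => //; rewrite -addnS; exact: bet0.
have h3 := gleD h1 h2; rewrite opprD addrA subrK in h3; apply: gleW h3.
have c0 : 0 <= c by have := gle_ge0 (hs 0%N); rewrite expr0 mulr1.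
have cz0 : 0 <= cz by have := gle_ge0 (bet0 0%N); rewrite expr0 mulr1.
rewrite mulrDl; apply: lerD; apply: ler_wpM2l => //;
  by apply: ler_wiXn2l; rewrite ?invr_ge0// ?leq_addl ?leqnSn// invf_le1// ler1n.
Qed.
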